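(* Let $C$ be an irreducible and reduced projective Gorenstein rational curve over $\mathbb{C}$ of arithmetic genus $g$ with a unique singular point, which is unibranch. Fix a smooth point $P_0\in C$ and an affine coordinate $u$ on the normalization $\mathbb{P}^1$ such that $P_0$ corresponds to $u=0$ and the singular point to $u=\infty$. Let $L=\omega_C(-(g-1)P_0)$. Let $\lambda_0$ and $\lambda_\infty$ be the Weierstrass partitions of $C$ at $P_0$ and at the singular point respectively. Then the tau function of $U=\iota(H^0(C,L(\infty P_0)))$ has the form $$\tau=\xi_{\lambda_0}\cdot\sigma_{\lambda_0}+\sum_{\lambda_0<\lambda'<\lambda_\infty}\xi_{\lambda'}\cdot\sigma_{\lambda'}+\xi_{\lambda_\infty}\cdot\sigma_{\lambda_\infty}$$ with $\xi_{\lambda_0}\neq0$ and $\xi_{\lambda_\infty}\neq0$ (when $\lambda_0=\lambda_\infty$ this reads $\tau=\xi_{\lambda_0}\sigma_{\lambda_0}$). In particular, $\tau$ is a polynomial, and its terms of lowest and highest weight are, up to nonzero scalars, $\sigma_{\lambda_0}$ and $\sigma_{\lambda_\infty}$ respectively.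
   Context: Partitions. $\nu:\mathbb P^1\to C$ is the normalization; unibranch means that the singular point $P_\infty$ has a single preimage. Its value semigroup $\mathbb H$ is the set of orders of vanishing at $u=\infty$ of $\nu^*f$, $0\ne f\in\mathcal O_{C,P_\infty}$; its gaps $w^\infty_1<\dots<w^\infty_g$ are the elements of $\mathbb N\setminus\mathbb H$ (there are exactly $g$). The gaps $w^0_1<\dots<w^0_g$ at the smooth point $P_0$ are the $k\ge1$ with $h^0(C,\mathcal O_C(kP_0))=h^0(C,\mathcal O_C((k-1)P_0))$. In either case the Weierstrass partition is $(w_g,\dots,w_1)-(g-1,\dots,1,0)$ componentwise. $\lambda<\mu$ means that the Young diagram of $\lambda$ is strictly contained in that of $\mu$. Dualizing sheaf. Global sections of $\omega_C$ are the meromorphic differentials $\omega$ on $\mathbb P^1$ with $\sum_{Q\in\nu^{-1}(P)}\operatorname{Res}_Q(\nu^*(f)\omega)=0$ for all $P\in C$, $f\in\mathcal O_{C,P}$. Tau functions. Let $V=\mathbb C(\!(u)\!)$ and $\pi:V\to\mathbb C[u^{-1}]$ the projection. A subspace $U\subset V$ is a point of the Sato Grassmannian if $\dim\ker\pi|_U=\dim\operatorname{coker}\pi|_U<\infty$. Such $U$ has a frame: a basis $f_j=\sum_i\xi_{i,j}u^{i+1}$ ($j\ge1$) for which there is $\ell$ with $\xi_{-j,j}=1$, $\xi_{i,j}=0$ for $i<-j$ whenever $j>\ell$, and $\xi_{i,j}=0$ for $i<-\ell$ whenever $j\le\ell$. For a partition $\lambda$ put $m_i=\lambda_i-i$ and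 $\xi_\lambda=\det(\xi_{m_i,j})_{i,j\ge1}$ (the stable value of the $N\times N$ truncations, $N\gg0$). Define $\sigma_i(\mathbf x)$ by $\exp(\sum_{i\ge1}x_it^i)=\sum_{i\ge0}\sigma_i(\mathbf x)t^i$ (and $\sigma_i=0$ for $i<0$), and the Schur–Weierstrass polynomial $\sigma_\lambda(\mathbf x)=\det(\sigma_{\lambda_i+j-i}(\mathbf x))_{1\le i,j\le m}$ for $\lambda=(\lambda_1,\dots,\lambda_m)$; it is homogeneous of weight $|\lambda|$ when $x_i$ has weight $i$. The tau function of $U$ is $\tau(\mathbf x)=\sum_\lambda\xi_\lambda\sigma_\lambda(\mathbf x)$ (sum over all partitions), well defined up to a nonzero scalar. Point $U$. $H^0(C,L(\infty P_0))=\bigcup_{n\ge0}H^0(C,L(nP_0))$, a space of differentials $f(u)du$, and $\iota(f(u)du)=u^{2-g}f(u)\in V$. The image $U$ is a point of the Sato Grassmannian; a frame is $\iota(\omega_1),\iota(\omega_2),\dots$ with $\omega_1,\dots,\omega_g$ a basis of $H^0(C,\omega_C)$ and $\omega_{g+i}=u^{-i-1}du$ for $i\ge1$. *)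

(* Defs.v *)
From HB Require Import structures.
From mathcomp Require Import all_boot all_order all_algebra.
From mathcomp Require Import fraction finmap.
From mathcomp Require Import boolp classical_sets functions cardinality fsbigop.
From mathcomp Require Import reals complex.
From mathcomp Require Import monalg.

Set Implicit Arguments.
Unset Strict Implicit.
Unset Printing Implicit Defensive.

Import Order.TTheory GRing.Theory Num.Theory.

Local Open Scope classical_set_scope.
Local Open Scope ring_scope.

(** * Rational functions on P^1 and their Laurent expansions *)

Local Notation "x %:F" := (@FracField.tofrac _ x) : ring_scope.

Section Laurent.
Context {F : fieldType}.
Local Notation K := {fraction {poly F}}.

(* [K] is the function field F(u) of P^1; a point of P^1 is an element of
   [option F], [Some a] being u = a and [None] being u = oo.  The function
   [int -> F] sending k to its k-th coefficient represents a Laurent series. *)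

Definition cst (c : F) : K := (c%:P)%:F.
Definition coord_u : K := ('X : {poly F})%:F.

Definition is_laurent (s : int -> F) : Prop :=
  exists n : int, forall k : int, k < n -> s k = 0.

(* The family below has finite support as soon as both series are Laurent. *)
Definition laurent_mul (s s' : int -> F) (k : int) : F :=
  \sum_(i \in [set: int]) s i * s' (k - i).

Definition poly_coef (p : {poly F}) (k : int) : F :=
  if k is Posz n then p`_n else 0.

(* Expansion of a polynomial in the local parameter t at Q:
   t = u - a at u = a, and t = 1/u at u = oo. *)
Definition poly_expansion (Q : option F) (p : {poly F}) : int -> F :=
  if Q is Some a then poly_coef (p \Po ('X + a%:P))
  else fun k => poly_coef p (- k).

(* The expansion s of f = p / q is the unique Laurent series with q s = p. *)
Definition expansion (Q : option F) (f : K) : int -> F :=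
  xget (fun=> 0) [set s | is_laurent s /\
    forall p q : {poly F}, f * q%:F = p%:F ->
      laurent_mul (poly_expansion Q q) s = poly_expansion Q p].

Definition regular_at (Q : option F) (f : K) : Prop :=
  forall k : int, k < 0 -> expansion Q f k = 0.

Definition value_at (Q : option F) (f : K) : F := expansion Q f 0.

Definition has_order (Q : option F) (f : K) (n : int) : Prop :=
  (forall k : int, k < n -> expansion Q f k = 0) /\ expansion Q f n != 0.

(* Residue of the differential f du; at infinity du = - t^(-2) dt. *)
Definition residue (Q : option F) (f : K) : F :=
  if Q is Some a then expansion Q f (-1) else - expansion Q f 1.

Definition has_dim (W : set K) (n : nat) : Prop :=
  exists2 b : 'I_n -> K, (forall i, W (b i)) &
    forall f, W f ->
      exists! c : {ffun 'I_n -> F}, f = \sum_(i < n) cst (c i) * b i.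

End Laurent.

(** * Integral projective rational curves *)

(* An integral projective curve with normalization nu : P^1 -> C is encoded, as
   in Serre, "Groupes algebriques et corps de classes", IV.1, by its points, the
   finite surjective map nu, and its local rings inside the function field F(u):
   each one is a subalgebra of finite codimension of the semilocal ring of
   functions regular along the fibre of nu, it is local (its elements are
   constant on the fibre), and almost all of them equal that semilocal ring.
   Conversely, over an algebraically closed field F, any such data is an
   integral projective curve. *)
Record rational_curve (F : fieldType) := RationalCurve {
  pt : Type;
  nu : option F -> pt;
  stalk : pt -> set {fraction {poly F}};
  nu_surj : forall P, exists Q, nu Q = P;
  nu_finite : forall P, finite_set [set Q | nu Q = P];
  stalk_cst : forall P c, stalk P (cst c);
  stalk_sub : forall P f h, stalk P f -> stalk P h -> stalk P (f - h);
  stalk_mul : forall P f h, stalk P f -> stalk P h -> stalk P (f * h);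
  stalk_regular : forall P f, stalk P f -> forall Q, nu Q = P -> regular_at Q f;
  stalk_value : forall P f, stalk P f ->
    forall Q Q', nu Q = P -> nu Q' = P -> value_at Q f = value_at Q' f;
  stalk_codim : forall P, exists n (e : 'I_n -> {fraction {poly F}}),
    forall f, (forall Q, nu Q = P -> regular_at Q f) ->
      exists c : 'I_n -> F, stalk P (f - \sum_(i < n) cst (c i) * e i);
  stalk_generic : finite_set
    [set P | stalk P <> [set f | forall Q, nu Q = P -> regular_at Q f]]
}.

Section Curve.
Context {F : fieldType} (C : rational_curve F).
Local Notation K := {fraction {poly F}}.

(* The normalization of the local ring at P. *)
Definition normal_stalk (P : pt C) : set K :=
  [set f | forall Q, nu C Q = P -> regular_at Q f].

(* A one-dimensional local ring is regular iff it is integrally closed. *)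
Definition smooth (P : pt C) : Prop := stalk P = normal_stalk P.
Definition singular (P : pt C) : Prop := ~ smooth P.

Definition unibranch (P : pt C) : Prop := exists! Q, nu C Q = P.

Definition P0 : pt C := nu C (Some 0).
Definition Poo : pt C := nu C None.

(* g = h^1(C, O_C).  As the constant sheaf K is flasque and K / O_C is the direct
   sum of the skyscraper sheaves K / O_P, H^1(C, O_C) is the cokernel of
   K -> (+)_P K / O_P, i.e. repartitions modulo (everywhere regular + K). *)
Definition repartition (r : pt C -> K) : Prop :=
  finite_set [set P | ~ stalk P (r P)].

Definition arithmetic_genus (g : nat) : Prop :=
  exists2 e : 'I_g -> pt C -> K, (forall i, repartition (e i)) &
    forall r, repartition r ->
      exists! c : {ffun 'I_g -> F}, exists f : K,
        forall P, stalk P (r P - \sum_(i < g) cst (c i) * e i P - f).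

(* Subsheaves of the constant sheaf K are given by their stalks.  A differential
   f du is identified with f, so this covers sheaves of differentials as well. *)
Definition H0 (S : pt C -> set K) : set K := [set f | forall P, S P f].

(* S(d P0); u is a local parameter at P0 when P0 is smooth. *)
Definition twist (S : pt C -> set K) (d : int) : pt C -> set K :=
  fun P => [set f | (P <> P0 -> S P f) /\ (P = P0 -> S P (coord_u ^ d * f))].

Definition omega (P : pt C) : set K :=
  [set w | forall f, stalk P f ->
     \sum_(Q \in [set Q | nu C Q = P]) residue Q (f * w) = 0].

(* Gorenstein: the dualizing sheaf is invertible. *)
Definition gorenstein : Prop :=
  forall P, exists w0, forall w,
    omega P w <-> exists2 h, stalk P h & w = h * w0.

Definition gaps0 : set nat :=
  [set k | (0 < k)%N /\ exists n, has_dim (H0 (twist (@stalk F C) k%:Z)) n /\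
                                  has_dim (H0 (twist (@stalk F C) (k%:Z - 1))) n].

Definition semigroup_oo : set nat :=
  [set n | exists2 f, stalk Poo f & has_order None f n%:Z].
Definition gaps_oo : set nat := ~` semigroup_oo.

(* The image under iota of H^0(C, L(oo P0)), where L = omega_C(-(g-1) P0). *)
Definition L (g : nat) : pt C -> set K := twist omega (1 - g%:Z).

Definition H0_L_ooP0 (g : nat) : set K :=
  \bigcup_(n in [set: nat]) H0 (twist (L g) n%:Z).

Definition iota (g : nat) (f : K) : int -> F :=
  expansion (Some 0) (coord_u ^ (2 - g%:Z) * f).

Definition U (g : nat) : set (int -> F) := iota g @` H0_L_ooP0 g.

End Curve.

(** * Partitions *)

Definition is_partition (l : seq nat) : bool := sorted geq l && (0%N \notin l).

Definition young_lt (l m : seq nat) : Prop :=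
  (forall i, (nth 0%N l i <= nth 0%N m i)%N) /\ l <> m.

(* (w_g, ..., w_1) - (g-1, ..., 0), where w_1 < ... < w_g enumerates G. *)
Definition weierstrass_partition (G : set nat) : seq nat :=
  let w := sort leq (fset_set G) in
  rev (mkseq (fun i => nth 0%N w i - i)%N (size w)).

(** * Schur-Weierstrass polynomials and tau functions *)

Section Tau.
Context {F : fieldType}.

(* The polynomial ring F[x_1, x_2, ...]; the generator U_(i) is x_(i+1).  Formal
   power series in the x_i are functions on the monomials. *)
Local Notation A := {malg F[{cmonom nat}]}.
Local Notation series := ({cmonom nat} -> F).

Definition var_x (i : nat) : A := if i is i'.+1 then << ucm i' >> else 0.

(* Coefficient of t^k in exp(sum_i x_i t^i); as the argument has no constant
   term, only its truncation at order k and its powers n <= k contribute. *)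
Definition sigma (k : nat) : A :=
  \sum_(n < k.+1) (n`!%:R^-1 : F) *: ((\poly_(i < k.+1) var_x i) ^+ n)`_k.

Definition sigmaz (k : int) : A := if k is Posz n then sigma n else 0.

Definition sigma_part (l : seq nat) : A :=
  \det (\matrix_(i < size l, j < size l)
          sigmaz ((nth 0%N l i)%:Z + j%:Z - i%:Z)).

(* [xi i j] is the coefficient of u^(i+1) in f_j; only j >= 1 is meaningful. *)
Definition is_frame (V : set (int -> F)) (xi : int -> nat -> F) : Prop :=
  [/\ forall j, (0 < j)%N -> V (fun k => xi (k - 1) j),
      forall v, V v -> exists n (c : nat -> F),
        forall k, v k = \sum_(1 <= j < n.+1) c j * xi (k - 1) j,
      forall n (c : nat -> F),
        (forall k, \sum_(1 <= j < n.+1) c j * xi (k - 1) j = 0) ->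
        forall j, (0 < j <= n)%N -> c j = 0
    & exists l : nat, forall j, (0 < j)%N ->
        if (l < j)%N then
          xi (- j%:Z) j = 1 /\ forall i : int, i < - j%:Z -> xi i j = 0
        else forall i : int, i < - l%:Z -> xi i j = 0].

Definition minor (xi : int -> nat -> F) (l : seq nat) (N : nat) : F :=
  \det (\matrix_(i < N, j < N) xi ((nth 0%N l i)%:Z - i.+1%:Z) j.+1).

Definition xi_part (xi : int -> nat -> F) (l : seq nat) : F :=
  xget 0 [set c | exists N0, forall N, (N0 <= N)%N -> minor xi l N = c].

(* For each monomial the sum is finite, sigma_part l being homogeneous of
   weight |l|. *)
Definition tau (xi : int -> nat -> F) : series :=
  fun m => \sum_(l \in [set l | is_partition l])
             xi_part xi l * (sigma_part l)@_m.

Definition weight (m : {cmonom nat}) : nat :=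
  (\sum_(i <- finsupp m) m i * i.+1)%N.

Definition weight_component (t : series) (n : nat) : series :=
  fun m => if weight m == n then t m else 0.

Definition lowest_term (t : series) (p : A) : Prop :=
  p != 0 /\ exists n : nat,
    (forall m, weight_component t n m = p@_m) /\
    forall k, (k < n)%N -> forall m, weight_component t k m = 0.

Definition highest_term (t : series) (p : A) : Prop :=
  p != 0 /\ exists n : nat,
    (forall m, weight_component t n m = p@_m) /\
    forall k, (n < k)%N -> forall m, weight_component t k m = 0.

End Tau.

(* Main.v *)
(* The pairing (f, w) |-> Res_oo (f w du) makes U orthogonal to the local ring O
   at P_oo.  Let v be a nonzero element of U and z the order (resp. the degree) of
   v, shifted as in [is_frame].  If z + g were neither negative nor a gap at P_0
   (resp. at P_oo), some f in O would have its pole at P_0 of order exactly z + g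
   (resp. would vanish at P_oo to order exactly z + g), and in the pairing of v
   with f a single term would survive.  As h^1(O_C) = g, there are at most g gaps
   of each kind, and linear algebra on the span of the first N frame elements shows
   that there are exactly g; the leading indices are then the Maya diagrams of
   lambda_0 and lambda_oo.  The minor of a partition lambda is nonzero iff no
   nonzero combination v of these N elements vanishes at all the indices
   lambda_i - i.  This holds for lambda_0 and lambda_oo by the above, and fails
   when lambda_k < (lambda_0)_k or lambda_k > (lambda_oo)_k for some k, by counting
   conditions. *)
Require Import Defs.
From HB Require Import structures.
From mathcomp Require Import all_boot all_order all_algebra.
From mathcomp Require Import perm fraction finmap generic_quotient.
From mathcomp Require Import boolp classical_sets functions cardinality fsbigop.
From mathcomp Require Import reals complex.
From mathcomp Require Import monalg.
From mathcomp Require Import zify ring.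

Import Order.TTheory GRing.Theory Num.Theory.

Local Open Scope classical_set_scope.
Local Open Scope ring_scope.

Local Notation "x %:F" := (@FracField.tofrac _ x) : ring_scope.

(** * Laurent series *)

(** The pairing is taken at P_oo alone, yet it sees P_0: the test functions used for lambda_0 are
    regular off P_0, hence Laurent polynomials in u, so that their pole order at P_0 is the last
    index of their expansion at P_oo. Elements of U are Laurent polynomials too, so lambda_0 and
    lambda_oo are read off at the two ends of the same finite lists of coefficients. The linear
    algebra is therefore done once, for an abstract relation [r] on indices, later < and >. Duality
    enters only as orthogonality; the lower bound on the number of gaps comes from freeness of the
    frame, since N independent elements cannot all have their leading indices among fewer than N
    places. The claims on the extreme terms rest on three further facts: sigma_lambda is homogeneous
    of weight |lambda|; a partition contained in another one of the same weight equals it, so that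
    lambda_0 and lambda_oo are alone at their weights; and sigma_lambda is nonzero, which is seen at
    x_1 = 1 and x_i = 0 for i > 1, where the determinant has reciprocals of factorials as
    entries. *)

Lemma int_offset (n z : int) : n <= z -> exists k : nat, z = n + k%:Z.
Proof. by move=> nz; exists `|(z - n)%R|%N; lia. Qed.

Lemma fsum_int_range {V : zmodType} (n : int) (N : nat) (G : int -> V) :
    (forall k, G k != 0 -> n <= k < n + N%:Z) ->
  \sum_(k \in [set: int]) G k = \sum_(i < N) G (n + i%:Z).
Proof.
move=> supp; pose r := [seq n + i%:Z | i <- iota 0 N].
rewrite (fsbigE r) //.
- rewrite big_map -(big_mkord xpredT (fun i => G (n + i%:Z))) /index_iota subn0.
  by apply: eq_bigl => i; rewrite in_setT.
- by rewrite map_inj_uniq ?iota_uniq // => i j /addrI [].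
- move=> k _; apply: contraNeq => /supp /andP[nk kn].
  have [i ki] := int_offset _ _ nk; apply/mapP; exists i => //.
  by rewrite mem_iota; lia.
Qed.

Section LaurentSeries.
Context {F : fieldType}.
Implicit Types (s : int -> F) (p q : {poly F}).

Definition below (n : int) s := forall k, k < n -> s k = 0.

Lemma below_le m n s : m <= n -> below n s -> below m s.
Proof. by move=> mn sn k km; apply: sn; apply: lt_le_trans mn. Qed.

(** [N] may exceed the length needed, so that products with different supports can be written over
    one common range. *)
Lemma laurent_mul_range {n m s s' z} (N : nat) :
    below n s -> below m s' -> z < n + m + N%:Z ->
  laurent_mul s s' z = \sum_(i < N) s (n + i%:Z) * s' (z - (n + i%:Z)).
Proof.
move=> sn sm zN; rewrite /laurent_mul (@fsum_int_range _ n N) // => k.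
rewrite mulf_eq0 negb_or => /andP[sk s'k].
case: (ltP k n) sk => [/sn->|nk _]; first by rewrite eqxx.
case: (ltP (z - k) m) s'k => [/sm->|zk _]; first by rewrite eqxx.
lia.
Qed.

Lemma laurent_mul_below {n m s s'} :
  below n s -> below m s' -> below (n + m) (laurent_mul s s').
Proof.
by move=> sn sm k kn; rewrite (laurent_mul_range 0 sn sm) ?big_ord0 ?addr0.
Qed.

Lemma laurent_mul_laurent {s s'} :
  is_laurent s -> is_laurent s' -> is_laurent (laurent_mul s s').
Proof. by move=> [n sn] [m sm]; exists (n + m); apply: laurent_mul_below. Qed.

(** Coefficients of a product of series up to a given index are those of a product of polynomials,
    so associativity can be borrowed from polynomials. *)
Definition principal (n : int) (N : nat) s : {poly F} := \poly_(i < N) s (n + i%:Z).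

Lemma laurent_mul_coef {n m s s'} {N k : nat} :
    below n s -> below m s' -> (k < N)%N ->
  laurent_mul s s' (n + m + k%:Z) = (principal n N s * principal m N s')`_k.
Proof.
move=> sn sm kN; rewrite (laurent_mul_range k.+1 sn sm); last by lia.
rewrite coefM; apply: eq_bigr => i _; rewrite !coef_poly.
rewrite (leq_ltn_trans _ kN) ?leq_ord // (leq_ltn_trans _ kN) ?leq_subr //.
by congr (_ * s' _); have := leq_ord i; lia.
Qed.

Lemma laurent_mulC : commutative (@laurent_mul F).
Proof.
move=> s s'; apply/funext => k; rewrite /laurent_mul.
rewrite (@reindex_fsbigT _ _ _ _ _ (fun i => k - i)); last first.
  by exists (fun i => k - i) => i; rewrite subKr.
by apply: eq_fsbigr => i _; rewrite subKr mulrC.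
Qed.

Lemma laurent_mulA s s' s'' : is_laurent s -> is_laurent s' -> is_laurent s'' ->
  laurent_mul s (laurent_mul s' s'') = laurent_mul (laurent_mul s s') s''.
Proof.
move=> [n sn] [m sm] [p sp]; apply/funext => z.
have [zl|zg] := ltP z (n + m + p).
  rewrite (laurent_mul_below (laurent_mul_below sn sm) sp) //.
  by rewrite (laurent_mul_below sn (laurent_mul_below sm sp)) ?addrA.
have [k ->] := int_offset _ _ zg.
rewrite (laurent_mul_coef (N := k.+1) (laurent_mul_below sn sm) sp) //.
rewrite -[n + m + p]addrA.
rewrite (laurent_mul_coef (N := k.+1) sn (laurent_mul_below sm sp)) //.
transitivity (principal n k.+1 s * (principal m k.+1 s' * principal p k.+1 s''))`_k.
  rewrite !coefM; apply: eq_bigr => i _; congr (_ * _).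
  rewrite [LHS]coef_poly ltnS leq_subr.
  by rewrite (laurent_mul_coef (N := k.+1) sm sp) // ltnS leq_subr.
rewrite mulrA !coefM; apply: eq_bigr => i _; congr (_ * _).
rewrite [RHS]coef_poly ltn_ord.
by rewrite (laurent_mul_coef (N := k.+1) sn sm).
Qed.

Lemma laurent_mulCA s s' s'' : is_laurent s -> is_laurent s' -> is_laurent s'' ->
  laurent_mul s (laurent_mul s' s'') = laurent_mul s' (laurent_mul s s'').
Proof. by move=> ls ls' ls''; rewrite !laurent_mulA // (laurent_mulC s). Qed.

Lemma laurent_lin (a : F) s s' : is_laurent s -> is_laurent s' ->
  is_laurent (fun k => a * s k + s' k).
Proof.
move=> [n sn] [m sm]; exists (Num.min n m) => k; rewrite lt_min => /andP[kn km].
by rewrite sn // sm // mulr0 addr0.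
Qed.

Lemma laurent_mul_lin s (a : F) s' s'' :
    is_laurent s -> is_laurent s' -> is_laurent s'' ->
  laurent_mul s (fun k => a * s' k + s'' k) =
  fun k => a * laurent_mul s s' k + laurent_mul s s'' k.
Proof.
move=> [n sn] [m' sm'] [p' sp']; apply/funext => z.
pose m := Num.min m' p'.
have sm : below m s' by apply: below_le sm'; rewrite ge_min lexx.
have sp : below m s'' by apply: below_le sp'; rewrite ge_min lexx orbT.
have sa : below m (fun k => a * s' k + s'' k).
  by move=> k km; rewrite sm // sp // mulr0 addr0.
have [N zN] : exists N : nat, z < n + m + N%:Z.
  by exists `|(z - (n + m))%R|.+1%N; lia.
rewrite !(laurent_mul_range N sn sm) // (laurent_mul_range N sn sp) //.
rewrite (laurent_mul_range N sn sa) //.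
rewrite mulr_sumr -big_split; apply: eq_bigr => i _ /=.
by rewrite mulrDr mulrCA.
Qed.

Lemma laurent_order s : is_laurent s -> s <> (fun=> 0) ->
  exists n, below n s /\ s n != 0.
Proof.
move=> [n sn] sN0.
have ex : exists k : nat, s (n + k%:Z) != 0.
  apply: contrapT => /forallNP s0; apply: sN0; apply/funext => z.
  have [/sn//|nz] := ltP z n.
  have [k zk] := int_offset _ _ nz.
  by apply/eqP/negP => /negP; rewrite zk => /s0.
case: (ex_minnP ex) => k sk kmin; exists (n + k%:Z); split=> // z zk.
have [/sn//|nz] := ltP z n.
have [i zi] := int_offset _ _ nz; apply/eqP; apply: contraTT zk.
by rewrite zi => /kmin; lia.
Qed.

Lemma laurent_mul_lead {n m s s'} : below n s -> below m s' ->
  laurent_mul s s' (n + m) = s n * s' m.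
Proof.
move=> sn sm; rewrite (laurent_mul_range 1 sn sm); last by lia.
by rewrite big_ord1 addr0 (_ : _ - n = m) //; lia.
Qed.

Lemma laurent_mul_eq0 s s' : is_laurent s -> is_laurent s' -> s <> (fun=> 0) ->
  laurent_mul s s' = (fun=> 0) -> s' = (fun=> 0).
Proof.
move=> ls ls' /(laurent_order _ ls)[n [sn sn0]] ss'0.
apply: contrapT => /(laurent_order _ ls')[m [sm sm0]].
have := laurent_mul_lead sn sm; rewrite ss'0 => /esym/eqP.
by rewrite mulf_eq0 (negPf sn0) (negPf sm0).
Qed.

Lemma laurent_mul_inj s s' s'' : is_laurent s -> is_laurent s' -> is_laurent s'' ->
  s <> (fun=> 0) -> laurent_mul s s' = laurent_mul s s'' -> s' = s''.
Proof.
move=> ls ls' ls'' s0 eq_s.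
have /laurent_mul_eq0 : laurent_mul s (fun k => -1 * s'' k + s' k) = (fun=> 0).
  by rewrite laurent_mul_lin // eq_s; apply/funext => k; rewrite mulN1r addNr.
move=> /(_ ls (laurent_lin _ _ _ ls'' ls') s0)/(congr1 (fun f => f _)) eq0.
by apply/funext => k; have /eqP := eq0 k; rewrite mulN1r addrC subr_eq0 => /eqP.
Qed.

(* The first k coefficients of the inverse of the power series a. *)
Fixpoint series_inv (a : nat -> F) (k : nat) : seq F :=
  if k is k'.+1 then
    let b := series_inv a k' in
    rcons b (((k' == 0)%:R - \sum_(i < k') a (k' - i)%N * b`_i) / a 0)
  else [::].

Lemma size_series_inv a k : size (series_inv a k) = k.
Proof. by elim: k => //= k IH; rewrite size_rcons IH. Qed.

Lemma nth_series_inv a k i : (i < k)%N ->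
  (series_inv a k)`_i = (series_inv a i.+1)`_i.
Proof.
elim: k => // k IH; rewrite ltnS leq_eqVlt => /predU1P[->//|ik].
by rewrite [in LHS]/= nth_rcons size_series_inv ik IH.
Qed.

Lemma series_invP a k : a 0%N != 0 ->
  \sum_(i < k.+1) a (k - i)%N * (series_inv a i.+1)`_i = (k == 0)%:R.
Proof.
move=> a0; rewrite big_ord_recr.
have -> : \sum_(i < k) a (k - i)%N * (series_inv a i.+1)`_i =
    \sum_(i < k) a (k - i)%N * (series_inv a k)`_i.
  by apply: eq_bigr => i _; rewrite (nth_series_inv a k).
rewrite /= nth_rcons size_series_inv ltnn eqxx subnn mulrCA divff // mulr1.
by rewrite addrC subrK.
Qed.

Lemma laurent_inv s : is_laurent s -> s <> (fun=> 0) ->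
  exists2 s', is_laurent s' & laurent_mul s s' = fun k => (k == 0)%:R.
Proof.
move=> ls /(laurent_order _ ls)[n [sn sn0]].
pose a i := s (n + i%:Z).
pose s' k := if k + n is Posz i then (series_inv a i.+1)`_i else 0.
have s'n : below (- n) s' by move=> k kn; rewrite /s'; case E: (k + n) => [i|//]; lia.
exists s'; first by exists (- n).
apply/funext => z.
have [zl|zg] := ltP z 0.
  by rewrite (laurent_mul_below sn s'n) ?subrr // (lt_eqF zl).
have [k] := int_offset _ _ zg; rewrite add0r => ->.
have a0 : a 0%N != 0 by rewrite /a addr0.
transitivity ((k == 0%N)%:R : F); last by congr (_%:R); lia.
rewrite -(series_invP a k a0) laurent_mulC.
rewrite (laurent_mul_range k.+1 s'n sn); last by lia.
apply: eq_bigr => i _; rewrite mulrC; congr (s _ * _); first by have := leq_ord i; lia.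
by rewrite /s' (_ : - n + i%:Z + n = i%:Z) //; lia.
Qed.

Lemma laurent_mul1 s : laurent_mul (fun k => (k == 0)%:R) s = s.
Proof.
apply/funext => z; rewrite /laurent_mul (@fsum_int_range _ 0 1).
  by rewrite big_ord1 /= mul1r subr0.
by move=> k; case: (eqVneq k 0) => [->|] //; rewrite mul0r eqxx.
Qed.

End LaurentSeries.

(** * Expansions of rational functions *)

Section Expansion.
Context {F : fieldType}.
Local Notation K := {fraction {poly F}}.
Implicit Types (s : int -> F) (p q : {poly F}) (Q : option F) (f h : K).

Lemma poly_coef_below p : below 0 (poly_coef p).
Proof. by case. Qed.

Lemma poly_coefM p q : poly_coef (p * q) = laurent_mul (poly_coef p) (poly_coef q).
Proof.
apply/funext => -[k|k]; last first.
  by rewrite (laurent_mul_below (poly_coef_below p) (poly_coef_below q)).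
rewrite (laurent_mul_range k.+1 (poly_coef_below p) (poly_coef_below q)); last by lia.
rewrite /= coefM; apply: eq_bigr => i _; rewrite add0r /=; congr (_ * _).
by rewrite subzn // -ltnS ltn_ord.
Qed.

Lemma poly_expansion_laurent Q p : is_laurent (poly_expansion Q p).
Proof.
case: Q => [a|]; first by exists 0; apply: poly_coef_below.
exists (- (size p)%:Z) => k kp /=.
have [i ki] : exists i : nat, k = - i%:Z by exists `|k|%N; lia.
by move: kp; rewrite ki opprK ltrN2 ltz_nat => /ltnW /(nth_default 0).
Qed.

Lemma poly_expansionM Q p q :
  poly_expansion Q (p * q) = laurent_mul (poly_expansion Q p) (poly_expansion Q q).
Proof.
case: Q => [a|] /=; first by rewrite comp_polyM poly_coefM.
apply/funext => k; rewrite poly_coefM /laurent_mul.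
rewrite (@reindex_fsbigT _ _ _ _ _ (fun i : int => - i)); last first.
  by exists (fun i => - i) => i; rewrite opprK.
by apply: eq_fsbigr => i _; congr (_ * poly_coef _ _); lia.
Qed.

Lemma poly_coef_lin (a : F) p q k :
  poly_coef (a *: p + q) k = a * poly_coef p k + poly_coef q k.
Proof. by case: k => k /=; rewrite ?coefD ?coefZ ?mulr0 ?addr0. Qed.

Lemma poly_expansion_lin Q (a : F) p q :
  poly_expansion Q (a *: p + q) =
  fun k => a * poly_expansion Q p k + poly_expansion Q q k.
Proof.
apply/funext => k; case: Q => [b|] /=; last by rewrite poly_coef_lin.
by rewrite comp_polyD comp_polyZ poly_coef_lin.
Qed.

Lemma poly_coef_inj p : poly_coef p = (fun=> 0) -> p = 0.
Proof. by move=> p0; apply/polyP => i; rewrite coef0 -[LHS]/(poly_coef p i%:Z) p0. Qed.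

Lemma poly_expansion_neq0 Q p : p != 0 -> poly_expansion Q p <> (fun=> 0).
Proof.
move=> p0 Qp0; move/eqP: p0; apply.
case: Q Qp0 => [a /poly_coef_inj/eqP|/= Qp0].
  by rewrite comp_poly_eq0 ?size_XaddC // => /eqP.
apply: poly_coef_inj; apply/funext => k.
by have := congr1 (fun s => s (- k)) Qp0; rewrite /= opprK.
Qed.

Lemma poly_expansion1 Q : poly_expansion Q 1 = fun k => (k == 0)%:R.
Proof.
apply/funext => k; case: Q => [a|] /=.
  by rewrite comp_polyC; case: k => [k|k]; rewrite /= ?coef1.
by case: k => [[|k]|k] //=; rewrite coefC.
Qed.

Lemma fraction_repr f : exists p q, q != 0 /\ f * q%:F = p%:F.
Proof.
elim/quotW: f => x; exists (frac x).1, (frac x).2; split; first exact: denom_ratioP.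
apply/eqP; rewrite !piE /= /FracField.equivf /FracField.mulf
  !numden_Ratio ?mulr1 ?oner_eq0 ?denom_ratioP //.
by rewrite mulrC.
Qed.

(** The definition of [expansion] quantifies over all fractions p / q representing f. By
    cross-multiplication and cancellation of a nonzero series, a single fraction suffices. *)
Lemma expansion_unique Q f s p q : is_laurent s -> q != 0 -> f * q%:F = p%:F ->
  laurent_mul (poly_expansion Q q) s = poly_expansion Q p -> expansion Q f = s.
Proof.
move=> ls q0 fqp qsp.
have lp r := poly_expansion_laurent Q r.
apply: xget_unique => [|s' [ls' /(_ _ _ fqp)]].
  split=> // p' q' fqp'; apply: (laurent_mul_inj (poly_expansion Q q)) => //.
  - exact: laurent_mul_laurent.
  - exact: poly_expansion_neq0.
  - rewrite laurent_mulCA // qsp -!poly_expansionM; congr (poly_expansion Q _).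
    apply/eqP; rewrite -tofrac_eq !tofracM -fqp -fqp'; apply/eqP.
    by rewrite mulrCA [RHS]mulrCA [q%:F * _]mulrC.
move=> qs'p; apply: (laurent_mul_inj (poly_expansion Q q)) => //.
- exact: poly_expansion_neq0.
- by rewrite qs'p.
Qed.

(** The [xget] in [expansion] never falls back on its default: the expansion of a nonzero
    denominator is invertible as a Laurent series. *)
Lemma expansionP Q f : is_laurent (expansion Q f) /\ forall p q, f * q%:F = p%:F ->
  laurent_mul (poly_expansion Q q) (expansion Q f) = poly_expansion Q p.
Proof.
have [p [q [q0 fqp]]] := fraction_repr f.
have lp r := poly_expansion_laurent Q r.
have [s ls qs1] := laurent_inv _ (lp q) (poly_expansion_neq0 _ _ q0).
have lsp : is_laurent (laurent_mul s (poly_expansion Q p)) by exact: laurent_mul_laurent.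
have qsp : laurent_mul (poly_expansion Q q) (laurent_mul s (poly_expansion Q p)) =
    poly_expansion Q p.
  by rewrite laurent_mulA // qs1 laurent_mul1.
rewrite (expansion_unique _ _ _ _ _ lsp q0 fqp qsp); split=> // p' q' fqp'.
apply: (laurent_mul_inj (poly_expansion Q q)) => //.
- exact: laurent_mul_laurent.
- exact: poly_expansion_neq0.
- rewrite laurent_mulCA // qsp -!poly_expansionM; congr (poly_expansion Q _).
  apply/eqP; rewrite -tofrac_eq !tofracM -fqp -fqp'; apply/eqP.
    by rewrite mulrCA [RHS]mulrCA [q%:F * _]mulrC.
Qed.

Lemma expansion_laurent Q f : is_laurent (expansion Q f).
Proof. by case: (expansionP Q f). Qed.

Lemma expansion_polyM Q p f :
  expansion Q (p%:F * f) = laurent_mul (poly_expansion Q p) (expansion Q f).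
Proof.
have [p' [q [q0 fqp]]] := fraction_repr f.
have [ls sP] := expansionP Q f; have lp r := poly_expansion_laurent Q r.
apply: (expansion_unique _ _ _ (p * p') q) => //.
- exact: laurent_mul_laurent.
- by rewrite -mulrA fqp tofracM.
- by rewrite laurent_mulCA // (sP _ _ fqp) poly_expansionM.
Qed.

Lemma expansion_lin Q (c : F) f h k :
  expansion Q (Defs.cst c * f + h) k = c * expansion Q f k + expansion Q h k.
Proof.
have [p [q [q0 fqp]]] := fraction_repr f; have [p' [q' [q'0 hqp]]] := fraction_repr h.
have [lf fP] := expansionP Q f; have [lh hP] := expansionP Q h.
have lp r := poly_expansion_laurent Q r.
suff -> : expansion Q (Defs.cst c * f + h) =
    fun k => c * expansion Q f k + expansion Q h k by [].
apply: (expansion_unique _ _ _ (c *: (p * q') + q * p') (q * q')).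
- exact: laurent_lin.
- by rewrite mulf_neq0.
- rewrite -mul_polyC !tofracD !tofracM -fqp -hqp /Defs.cst; ring.
- rewrite poly_expansion_lin laurent_mul_lin ?poly_expansionM -?laurent_mulA //.
    rewrite laurent_mulCA // (fP _ _ fqp) (hP _ _ hqp).
    by rewrite [laurent_mul (poly_expansion Q q') _]laurent_mulC.
  exact: laurent_mul_laurent.
Qed.

Lemma expansion_poly Q p : expansion Q p%:F = poly_expansion Q p.
Proof.
apply: (expansion_unique _ _ _ p 1); rewrite ?oner_eq0 ?tofrac1 ?mulr1 //.
  exact: poly_expansion_laurent.
by rewrite poly_expansion1 laurent_mul1.
Qed.

Lemma expansion0 Q k : expansion Q 0 k = 0 :> F.
Proof.
rewrite -tofrac0 expansion_poly; case: Q => [a|] /=; rewrite ?comp_poly0.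
  by case: k => i //=; rewrite coef0.
by case: (- k) => i //=; rewrite coef0.
Qed.

Lemma expansionD Q f h k : expansion Q (f + h) k = expansion Q f k + expansion Q h k.
Proof. by have := expansion_lin Q 1 f h k; rewrite /Defs.cst tofrac1 !mul1r. Qed.

Lemma expansionZ Q c f k : expansion Q (Defs.cst c * f) k = c * expansion Q f k.
Proof. by rewrite -[Defs.cst c * f]addr0 expansion_lin expansion0 addr0. Qed.

Lemma expansionN Q f k : expansion Q (- f) k = - expansion Q f k.
Proof. by apply/eqP; rewrite -addr_eq0 -expansionD addNr expansion0. Qed.

Lemma expansion_sum Q (I : Type) (r : seq I) (P : pred I) (G : I -> K) k :
  expansion Q (\sum_(i <- r | P i) G i) k = \sum_(i <- r | P i) expansion Q (G i) k.
Proof. by elim/big_rec2: _ => [|i x y _ <-]; rewrite ?expansion0 ?expansionD. Qed.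

Lemma laurent_mul_delta (n : int) s :
  laurent_mul (fun k => (k == n)%:R) s = fun k => s (k - n).
Proof.
apply/funext => z; rewrite /laurent_mul (@fsum_int_range _ n 1).
  by rewrite big_ord1 addr0 eqxx mul1r.
by move=> k; case: (eqVneq k n) => [->|] ; rewrite ?mul0r ?eqxx //; lia.
Qed.

Lemma expansion_XsubC_exp (a : F) n f k :
  expansion (Some a) ((('X - a%:P) ^+ n)%:F * f) k = expansion (Some a) f (k - n%:Z).
Proof.
rewrite expansion_polyM /= rmorphXn /= rmorphB /= comp_polyX comp_polyC addrK.
rewrite (_ : poly_coef _ = fun k : int => (k == n%:Z)%:R) ?laurent_mul_delta //.
by apply/funext => -[i|i] //=; rewrite coefXn.
Qed.

Lemma expansion0_u_exp (n : nat) f k :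
  expansion (Some 0) (coord_u ^+ n * f) k = expansion (Some 0) f (k - n%:Z).
Proof. by rewrite -expansion_XsubC_exp subr0 tofracXn. Qed.

Lemma expansionoo_u_exp (n : nat) f k :
  expansion None (coord_u ^+ n * f) k = expansion None f (k + n%:Z).
Proof.
rewrite -tofracXn expansion_polyM /=.
rewrite (_ : (fun k => _) = fun k : int => (k == - n%:Z)%:R) ?laurent_mul_delta ?opprK //.
apply/funext => i /=; rewrite -[i == _](inj_eq oppr_inj) opprK.
by case: (- i) => j //=; rewrite coefXn.
Qed.

Lemma coord_u_neq0 : coord_u != 0 :> K.
Proof. by rewrite tofrac_eq0 polyX_eq0. Qed.

Lemma expansion0_u_expz (n : int) f k :
  expansion (Some 0) (coord_u ^ n * f) k = expansion (Some 0) f (k - n).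
Proof.
case: n => n; first exact: expansion0_u_exp.
rewrite -[f in RHS](mulVKf (expf_neq0 n.+1 coord_u_neq0)) expansion0_u_exp.
by rewrite NegzE exprnN; congr (expansion _ (_ * _) _); lia.
Qed.

Lemma expansionoo_u_expz (n : int) f k :
  expansion None (coord_u ^ n * f) k = expansion None f (k + n).
Proof.
case: n => n; first exact: expansionoo_u_exp.
rewrite -[f in RHS](mulVKf (expf_neq0 n.+1 coord_u_neq0)) expansionoo_u_exp.
by rewrite NegzE exprnN; congr (expansion _ (_ * _) _); lia.
Qed.

Lemma regular_poly (a : F) p : regular_at (Some a) p%:F.
Proof. by move=> k; rewrite expansion_poly; apply: poly_coef_below. Qed.

Lemma regular_lin Q (c : F) f h : regular_at Q f -> regular_at Q h ->
  regular_at Q (Defs.cst c * f + h).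
Proof. by move=> rf rh k k0; rewrite expansion_lin rf // rh // mulr0 addr0. Qed.

Lemma expansion_cst Q c k : expansion Q (Defs.cst c) k = (if k == 0 then c else 0).
Proof.
rewrite -[Defs.cst c]mulr1 expansionZ -tofrac1 expansion_poly poly_expansion1.
by case: eqP; rewrite ?mulr1 ?mulr0.
Qed.

End Expansion.

(** * Functions regular at all finite points *)

Section ClosedField.
Context {F : closedFieldType}.
Local Notation K := {fraction {poly F}}.

(** A nonconstant denominator has a root a, the field being closed. Regularity at a makes a a root
    of the numerator as well, so X - a cancels and the degree of the denominator drops. *)
Lemma regular_finite_poly (f : K) : (forall a, regular_at (Some a) f) ->
  exists p : {poly F}, f = p%:F.
Proof.
move=> freg; have [p [q [q0 fqp]]] := fraction_repr f.
have [n] := ubnP (size q); elim: n => // n IH in p q q0 fqp *; rewrite ltnS => qn.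
have [/size_poly1P[c c0 qc]|/closed_rootP[a qa]] := boolP (size q == 1%N).
  exists (c^-1 *: p); rewrite -mul_polyC tofracM -fqp qc mulrCA -tofracM -polyCM.
  by rewrite mulVf // tofrac1 mulr1.
have pa : root p a.
  have [ls /(_ _ _ fqp)] := expansionP (Some a) f.
  (* The coefficient of index 0 of a product of two series without negative part is the product of
     the constant terms, here q(a) = 0 times a finite value. *)
  move/(congr1 (fun s => s (0 + 0))).
  rewrite (laurent_mul_lead (poly_coef_below _) (freg a)) addr0 /= -!horner_coef0.
  by rewrite !horner_comp !hornerE /= (rootP qa) mul0r => /esym/eqP.
move/factor_theorem: qa q0 fqp qn => [q' ->]; move/factor_theorem: pa => [p' ->].
rewrite mulf_eq0 negb_or => /andP[q'0 X0]; rewrite !tofracM mulrA => fqp qn.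
apply: (IH p' q') => //; last first.
  by move: qn; rewrite size_Mmonic ?monicXsubC // size_XsubC addn2 /=.
by move/mulIf: fqp; apply; rewrite tofrac_eq0.
Qed.

End ClosedField.

(** * Subspaces of the function field *)

Lemma exists_left_kernel {F : fieldType} {m n : nat} (A : 'M[F]_(m, n)) : (n < m)%N ->
  exists2 a : 'rV_m, a != 0 & a *m A = 0.
Proof.
move=> nm; have : kermx A != 0.
  by rewrite -mxrank_eq0 mxrank_ker subn_eq0 -ltnNge (leq_ltn_trans (rank_leq_col A)).
by move=> /rowV0Pn[a /sub_kermxP aA a0]; exists a.
Qed.

Lemma rV_neq0 {F : fieldType} {n : nat} (a : 'rV[F]_n) : a != 0 -> exists i, a 0 i != 0.
Proof.
by rewrite -subr_eq0 subr0 => /matrix0Pn[i [j aij]]; exists j; rewrite -(ord1 i).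
Qed.

Lemma widen_ord_lift n (j : 'I_n) : widen_ord (leqnSn n) j = lift ord_max j.
Proof. by apply: val_inj; rewrite /= /bump leqNgt ltn_ord. Qed.

Section Subspaces.
Context {F : fieldType}.
Local Notation K := {fraction {poly F}}.
Implicit Types (V : set K) (f : K).

Definition subspace V := V 0 /\ forall c f h, V f -> V h -> V (Defs.cst c * f + h).

Lemma subspace_sum V (I : Type) (r : seq I) (c : I -> F) (b : I -> K) : subspace V ->
  (forall i, V (b i)) -> V (\sum_(i <- r) Defs.cst (c i) * b i).
Proof. by move=> [V0 VD] Vb; elim/big_rec: _ => // i x _; apply: VD. Qed.

Lemma cst0 : Defs.cst 0 = 0 :> K. Proof. by rewrite /Defs.cst polyC0 tofrac0. Qed.
Lemma cst1 : Defs.cst 1 = 1 :> K. Proof. by rewrite /Defs.cst tofrac1. Qed.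
Lemma cstN c : Defs.cst (- c) = - Defs.cst c :> K.
Proof. by rewrite /Defs.cst polyCN tofracN. Qed.
Lemma cstD c d : Defs.cst (c + d) = Defs.cst c + Defs.cst d :> K.
Proof. by rewrite /Defs.cst polyCD tofracD. Qed.
Lemma cstM c d : Defs.cst (c * d) = Defs.cst c * Defs.cst d :> K.
Proof. by rewrite /Defs.cst polyCM tofracM. Qed.
Lemma cst_sum (I : Type) (r : seq I) (c : I -> F) :
  Defs.cst (\sum_(i <- r) c i) = \sum_(i <- r) Defs.cst (c i) :> K.
Proof. by elim/big_rec2: _ => [|i x y _ <-]; rewrite ?cst0 ?cstD. Qed.

Lemma subspaceZ V c f : subspace V -> V f -> V (Defs.cst c * f).
Proof. by move=> [V0 VD] Vf; rewrite -[_ * _]addr0; apply: VD. Qed.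

Lemma subspaceB V f h : subspace V -> V f -> V h -> V (f - h).
Proof.
by move=> [V0 VD] Vf Vh; rewrite addrC -[- h]mulN1r -cst1 -cstN; apply: VD.
Qed.

Lemma sum_coordinates {m n : nat} (a : 'rV[F]_m) (A : 'M[F]_(m, n)) (b : 'I_n -> K)
    (x : 'I_m -> K) : (forall i, x i = \sum_(j < n) Defs.cst (A i j) * b j) ->
  \sum_(i < m) Defs.cst (a 0 i) * x i = \sum_(j < n) Defs.cst ((a *m A) 0 j) * b j.
Proof.
move=> xE; under eq_bigr do rewrite xE mulr_sumr.
rewrite exchange_big; apply: eq_bigr => j _; rewrite mxE cst_sum mulr_suml.
by apply: eq_bigr => i _; rewrite cstM mulrA.
Qed.

(** The basis of V' and f are n + 1 vectors in a space of dimension n, hence dependent, and the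
    coefficient of f in the relation is invertible. At a gap this identifies two consecutive pole
    spaces. *)
Lemma has_dim_full V V' n : subspace V' -> V' `<=` V ->
  has_dim V n -> has_dim V' n -> V `<=` V'.
Proof.
move=> sV' V'V [b bV bP] [b' b'V' b'P] f Vf.
pose x (i : 'I_n.+1) := if unlift ord_max i is Some j then b' j else f.
have /choice[c cP] : forall i, exists c : {ffun 'I_n -> F},
    x i = \sum_(j < n) Defs.cst (c j) * b j.
  move=> i; have [|c [xc _]] := bP (x i); last by exists c.
  by rewrite /x; case: unliftP => [j|] _ //; apply: V'V.
have [a a0 aA] := exists_left_kernel (\matrix_(i, j) c i j) (ltnSn n).
have xE i : x i = \sum_(j < n) Defs.cst ((\matrix_(i, j) c i j) i j) * b j.
  by rewrite cP; apply: eq_bigr => j _; rewrite mxE.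
have := sum_coordinates a _ b x xE; rewrite aA.
rewrite [RHS]big1 => [|j _]; last by rewrite mxE cst0 mul0r.
rewrite big_ord_recr /= {2}/x unlift_none => sum0.
have xb j : x (widen_ord (leqnSn n) j) = b' j.
  by rewrite /x widen_ord_lift liftK.
(* Without f, the relation would give 0 two distinct coordinate vectors on the basis of V'. *)
have [an|an] := eqVneq (a 0 ord_max) 0.
  rewrite an cst0 mul0r addr0 in sum0.
  have [c0 [_ c0P]] := b'P 0 sV'.1.
  have e1 : c0 = [ffun i => a 0 (widen_ord (leqnSn n) i)].
    by apply: c0P; apply: etrans (esym sum0) _; apply: eq_bigr => j _; rewrite xb ffunE.
  have e2 : c0 = [ffun i => 0].
    by apply: c0P; rewrite big1 // => j _; rewrite ffunE cst0 mul0r.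
  have [i ai] := rV_neq0 _ a0.
  case: (unliftP ord_max i) ai => [j ->|->]; last by rewrite an eqxx.
  have := congr1 (fun c : {ffun 'I_n -> F} => c j) (etrans (esym e1) e2).
  by rewrite !ffunE widen_ord_lift => ->; rewrite eqxx.
have -> : f = Defs.cst (- (a 0 ord_max)^-1) *
    \sum_(j < n) Defs.cst (a 0 (widen_ord (leqnSn n) j)) * b' j.
  move: sum0; under eq_bigr do rewrite xb.
  move/eqP; rewrite addr_eq0 => /eqP ->; rewrite cstN mulrNN mulrA -cstM mulVf //.
  by rewrite cst1 mul1r.
by apply: subspaceZ => //; apply: subspace_sum.
Qed.

(** V' is a hyperplane of V complemented by f: the induction step for the finite dimension of the
    pole spaces. *)
Lemma has_dim_extend V V' n f : subspace V -> subspace V' -> V' `<=` V ->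
    has_dim V' n -> V f -> ~ V' f ->
    (forall h, V h -> exists c, V' (h - Defs.cst c * f)) -> has_dim V n.+1.
Proof.
move=> sV sV' V'V [b bV' bP] Vf nV'f Vdec.
pose x (i : 'I_n.+1) := if unlift ord_max i is Some j then b j else f.
have xb j : x (widen_ord (leqnSn n) j) = b j.
  by rewrite /x widen_ord_lift liftK.
have xsum (c : 'I_n.+1 -> F) : \sum_(i < n.+1) Defs.cst (c i) * x i =
    \sum_(j < n) Defs.cst (c (widen_ord (leqnSn n) j)) * b j + Defs.cst (c ord_max) * f.
  rewrite big_ord_recr /= {2}/x unlift_none; congr (_ + _).
  by apply: eq_bigr => j _; rewrite xb.
exists x => [i|h Vh].
  by rewrite /x; case: unliftP => [j|] _ //; apply: V'V.
have [c V'hc] := Vdec _ Vh; have [d [dE dP]] := bP _ V'hc.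
exists [ffun i => if unlift ord_max i is Some j then d j else c]; split.
  rewrite xsum !ffunE unlift_none -[LHS](subrK (Defs.cst c * f)) dE.
  by congr (_ + _); apply: eq_bigr => j _; rewrite ffunE widen_ord_lift liftK.
move=> d'; rewrite xsum => hE.
have cE : c = d' ord_max.
  apply: contrapT => cd; apply: nV'f.
  have cd0 : d' ord_max - c != 0 by rewrite subr_eq0; apply/eqP => /esym.
  have -> : f = Defs.cst (d' ord_max - c)^-1 * ((h - Defs.cst c * f) -
      \sum_(j < n) Defs.cst (d' (widen_ord (leqnSn n) j)) * b j).
    rewrite (_ : h - _ - _ = Defs.cst (d' ord_max - c) * f); last first.
      by rewrite {1}hE cstD cstN; ring.
    by rewrite mulrA -cstM mulVf // cst1 mul1r.
  by apply: subspaceZ => //; apply: subspaceB => //; apply: subspace_sum.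
have dE' : d = [ffun j => d' (widen_ord (leqnSn n) j)].
  by apply: dP; rewrite {1}hE cE addrK; apply: eq_bigr => j _; rewrite ffunE.
apply/ffunP => i; rewrite ffunE; case: unliftP => [j ->|->] //.
by rewrite dE' ffunE widen_ord_lift.
Qed.

End Subspaces.

(** * Residue duality and gaps *)

Section Curve.
Context {F : closedFieldType} (C : rational_curve F).
Local Notation K := {fraction {poly F}}.

Lemma stalk_subspace (P : pt C) : subspace (stalk P).
Proof.
have s0 : stalk P 0 by rewrite -cst0; apply: stalk_cst.
split=> // c f h Pf Ph; rewrite -[h]opprK; apply: stalk_sub.
  by apply: stalk_mul => //; apply: stalk_cst.
by rewrite -[- h]add0r; apply: stalk_sub.
Qed.

(* The cokernel in [arithmetic_genus] has dimension g, so the classes of g + 1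
   principal parts at P are linearly dependent. *)
Lemma principal_parts_dependent {g : nat} (P : pt C) (h : 'I_g.+1 -> K) :
    arithmetic_genus C g ->
  exists2 a : 'I_g.+1 -> F, exists i, a i != 0 &
    exists2 f, forall P', P' <> P -> stalk P' f
             & stalk P (\sum_(i < g.+1) Defs.cst (a i) * h i - f).
Proof.
move=> [e _ eP]; pose r i P' := if `[< P' = P >] then h i else 0.
have rP i : repartition (r i).
  apply: (@sub_finite_set _ _ [set P]); last exact: finite_set1.
  move=> P' /=; rewrite /r; case: asboolP => // _ []; exact: (stalk_subspace P').1.
have /choice[c cP] : forall i, exists x : {ffun 'I_g -> F} * K,
    forall P', stalk P' (r i P' - \sum_(j < g) Defs.cst (x.1 j) * e j P' - x.2).
  by move=> i; have [c [[f fP] _]] := eP _ (rP i); exists (c, f).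
have [a a0 aA] := exists_left_kernel (\matrix_(i, j) (c i).1 j) (ltnSn g).
have comb P' : stalk P' (\sum_(i < g.+1) Defs.cst (a 0 i) * r i P' -
    \sum_(i < g.+1) Defs.cst (a 0 i) * (c i).2).
  have := subspace_sum _ _ (index_enum 'I_g.+1) (a 0) _ (stalk_subspace P') (cP ^~ P').
  under eq_bigr do rewrite !mulrBr; rewrite !sumrB.
  rewrite (sum_coordinates a (\matrix_(i, j) (c i).1 j) (fun j => e j P')
    (fun i => \sum_(j < g) Defs.cst ((c i).1 j) * e j P')); last first.
    by move=> i; apply: eq_bigr => j _; rewrite mxE.
  by rewrite aA [X in _ - X - _]big1 ?subr0 // => j _; rewrite mxE cst0 mul0r.
exists (a 0); first exact: rV_neq0.
exists (\sum_(i < g.+1) Defs.cst (a 0 i) * (c i).2) => [P' P'P|].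
  have := comb P'; rewrite [X in X - _]big1 => [|i _]; last first.
    by rewrite /r; case: asboolP => //; rewrite mulr0.
  move=> /(subspaceB _ _ _ (stalk_subspace P') (stalk_subspace P').1).
  by rewrite !sub0r opprK.
have := comb P; under eq_bigr do rewrite /r (asboolT (erefl P)).
by [].
Qed.

End Curve.

Section UnibranchCurve.
Context {F : closedFieldType} {C : rational_curve F}.
Context (hsing : forall P : pt C, singular P <-> P = Poo C).
Context (hunib : unibranch (Poo C)) (hP0 : smooth (P0 C)).
Local Notation K := {fraction {poly F}}.
Implicit Types (f w : K).

Lemma nu_oo Q : nu C Q = Poo C -> Q = None.
Proof. by move: hunib => [Q0 [_ Q0P]] /Q0P <-; apply: Q0P. Qed.

Lemma smooth_finite (a : F) : smooth (nu C (Some a)).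
Proof. by apply: contrapT => /hsing/nu_oo. Qed.

(* Two points of the fibre of a smooth point would be separated by u. *)
Lemma nu_finite_inj (a : F) Q : nu C Q = nu C (Some a) -> Q = Some a.
Proof.
case: Q => [b|]; last by move/esym/nu_oo.
move=> ba; have Xa : stalk (nu C (Some a)) ('X : {poly F})%:F.
  rewrite smooth_finite => -[c _|]; [exact: regular_poly|by move/esym/nu_oo].
have := stalk_value Xa ba erefl.
by rewrite /value_at !expansion_poly /= !comp_polyX !coefD !coefX !coefC !add0r => ->.
Qed.

Lemma stalk_finite (a : F) f : stalk (nu C (Some a)) f <-> regular_at (Some a) f.
Proof.
rewrite smooth_finite; split=> [|fa Q /nu_finite_inj-> //].
by move=> /(_ _ erefl).
Qed.

Lemma stalk_oo f : stalk (Poo C) f -> regular_at None f.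
Proof. by move=> /stalk_regular; apply. Qed.

Lemma P0_neq_oo : P0 C <> Poo C.
Proof. by move=> /hsing; apply. Qed.

(** The powers of u - a lie in the local ring, and the residue of (u - a)^n w du is the coefficient
    of w of index -1 - n, so all polar coefficients vanish. *)
Lemma omega_finite (a : F) w : omega (nu C (Some a)) w -> regular_at (Some a) w.
Proof.
move=> wa k k0.
have [n kn] : exists n : nat, k = -1 - n%:Z by exists `|(-1 - k)%R|%N; lia.
have := wa ((('X - a%:P) ^+ n)%:F); rewrite stalk_finite => /(_ (regular_poly _ _)).
rewrite (_ : [set Q | _] = [set Some a]); last first.
  by apply/seteqP; split=> Q; [apply: nu_finite_inj|move=> /= ->].
by rewrite fsbig_set1 /= expansion_XsubC_exp kn.
Qed.

Lemma omega_oo w f : omega (Poo C) w -> stalk (Poo C) f -> expansion None (f * w) 1 = 0.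
Proof.
move=> wo /wo; rewrite (_ : [set Q | _] = [set None]); last first.
  by apply/seteqP; split=> Q; [apply: nu_oo|move=> /= ->].
by rewrite fsbig_set1 /= => /eqP; rewrite oppr_eq0 => /eqP.
Qed.

Lemma regular_polyM (a : F) (p : {poly F}) f :
  regular_at (Some a) f -> regular_at (Some a) (p%:F * f).
Proof.
move=> fa k k0; rewrite expansion_polyM.
by rewrite (laurent_mul_below (poly_coef_below _) fa).
Qed.

Lemma laurent_polynomial (n : nat) f : (forall a, a != 0 -> regular_at (Some a) f) ->
    (forall k, k < - n%:Z -> expansion (Some 0) f k = 0) ->
  exists p : {poly F}, f = coord_u ^ (- n%:Z) * p%:F.
Proof.
move=> fa f0; have [a|p fp] := regular_finite_poly (coord_u ^+ n * f).
  have [->|/fa/regular_polyM] := eqVneq a 0.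
    by move=> k k0; rewrite expansion0_u_exp f0 //; lia.
  by rewrite -tofracXn; apply.
by exists p; rewrite -fp -exprnN mulKf // expf_neq0 // coord_u_neq0.
Qed.

Lemma expansion0_laurent_poly (m : int) (p : {poly F}) k :
  expansion (Some 0) (coord_u ^ m * p%:F) k = poly_coef p (k - m).
Proof. by rewrite expansion0_u_expz expansion_poly /= addr0 comp_polyXr. Qed.

Lemma expansionoo_laurent_poly (m : int) (p : {poly F}) k :
  expansion None (coord_u ^ m * p%:F) k = poly_coef p (- (k + m)).
Proof. by rewrite expansionoo_u_expz expansion_poly. Qed.

Lemma regular_expz0 (m : int) f :
  regular_at (Some 0) (coord_u ^ m * f) <->
  forall k, k < - m -> expansion (Some 0) f k = 0.
Proof.
split=> fm k km; last by rewrite expansion0_u_expz fm //; lia.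
by have := fm (k + m); rewrite expansion0_u_expz addrK; apply; lia.
Qed.

Definition finite_range (w : int -> F) :=
  exists n (N : nat), forall k, w k != 0 -> n <= k < n + N%:Z.

(* Serre duality: the residue pairing with sections of O_C vanishes on U.  The
   index is shifted as in [is_frame]. *)
Definition annihilates (g : nat) (w : int -> F) := forall f, stalk (Poo C) f ->
  \sum_(i \in [set: int]) w i * expansion None f (i + g%:Z) = 0.

(** A section w is regular at the finite points other than 0, so it is a Laurent polynomial, and its
    coefficients at u = 0 are those at u = oo read backwards. Frame index i stands for u^(i+1) after
    multiplication by u^(2-g), that is, for u^(i+g-1) in w; in the residue of f w du it meets the
    term u^(-i-g) of f, which has index i + g at infinity. *)
Lemma U_annihilates (g : nat) v : U C g v ->
  finite_range (fun i => v (i + 1)) /\ annihilates g (fun i => v (i + 1)).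
Proof.
move=> [w [n _ wH] <-].
have wa a : a != 0 -> regular_at (Some a) w.
  move=> a0; apply: omega_finite.
  have aP0 : nu C (Some a) <> P0 C by move/nu_finite_inj => [/eqP]; rewrite (negPf a0).
  by have := (wH (nu C (Some a))).1 aP0 => -[]; move/(_ aP0).
have woo : omega (Poo C) w.
  have ooP0 : Poo C <> P0 C by move/esym/P0_neq_oo.
  by have := (wH (Poo C)).1 ooP0 => -[]; move/(_ ooP0).
have [M w0] : exists M : nat, forall k, k < - M%:Z -> expansion (Some 0) w k = 0.
  have [m wm] := expansion_laurent (Some 0) w.
  by exists `|m|%N => k km; apply: wm; lia.
have [p wE] := laurent_polynomial M w wa w0.
(* The index at which the constant term of p sits, after the factors u^(-M) and u^(2-g) and the
   shift by one. *)
pose e : int := 1 - g%:Z - M%:Z.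
have vE i : Defs.iota g w (i + 1) = poly_coef p (i - (1 - g%:Z - M%:Z)).
  rewrite /Defs.iota wE mulrA -expfzDr ?coord_u_neq0 // expansion0_laurent_poly.
  by congr (poly_coef _ _); lia.
split.
  exists e, (size p) => k; rewrite vE -/e.
  case E: (k - e) => [i|i]; rewrite /= ?eqxx // => pi.
  have : (i < size p)%N by rewrite ltnNge; apply: contra pi => /(nth_default 0)->.
  by move/eqP: E; rewrite subr_eq => /eqP ->; move: (size p) => s; lia.
move=> f Of; have := omega_oo _ _ woo Of.
rewrite wE mulrCA expansionoo_u_expz mulrC expansion_polyM /laurent_mul.
rewrite (@reindex_fsbigT _ _ _ _ _ (fun i => e - i)) => [H|]; last first.
  by exists (fun i => e - i) => i; rewrite subKr.
rewrite -[RHS]H; apply: eq_fsbigr => i _; rewrite -wE vE /=.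
by congr (poly_coef _ _ * expansion _ _ _); rewrite /e; lia.
Qed.

End UnibranchCurve.

Arguments annihilates {F} C g w.

Lemma max_index {g : nat} (t : 'I_g -> nat) (P : pred 'I_g) : (exists i, P i) ->
  exists2 i, P i & forall j, P j -> (t j <= t i)%N.
Proof. by case=> i0 Pi0; case: (arg_maxnP t Pi0) => i Pi tP; exists i. Qed.

Lemma min_index {g : nat} (t : 'I_g -> nat) (P : pred 'I_g) : (exists i, P i) ->
  exists2 i, P i & forall j, P j -> (t i <= t j)%N.
Proof. by case=> i0 Pi0; case: (arg_minnP t Pi0) => i Pi tP; exists i. Qed.

(** * Counting the gaps at P_0 and at P_oo *)

Section Gaps.
Context {F : closedFieldType} {C : rational_curve F}.
Context (hsing : forall P : pt C, singular P <-> P = Poo C).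
Context (hunib : unibranch (Poo C)) (hP0 : smooth (P0 C)).
Local Notation K := {fraction {poly F}}.
Implicit Types (f : K).

Definition pole_space (k : int) := H0 (twist (@stalk F C) k).

Lemma pole_spaceP (k : int) f : pole_space k f <->
  [/\ stalk (Poo C) f, forall a, a != 0 -> regular_at (Some a) f
    & forall j, j < - k -> expansion (Some 0) f j = 0].
Proof.
have ooP0 : Poo C <> P0 C by move/esym/(P0_neq_oo hsing hP0).
have aP0 a : a != 0 -> nu C (Some a) <> P0 C.
  by move=> a0 /(nu_finite_inj hsing hunib)[/eqP]; rewrite (negPf a0).
split=> [fk|[foo fa f0] P].
  split.
  - exact: (fk (Poo C)).1.
  - move=> a a0; apply/(stalk_finite hsing hunib).
    exact: (fk (nu C (Some a))).1 (aP0 _ a0).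
  - apply/regular_expz0; apply/(stalk_finite hsing hunib).
    exact: (fk (P0 C)).2.
have [[a|] <-] := nu_surj P; last by split=> // /ooP0.
have [->|a0] := eqVneq a 0; split=> aP.
- by case: aP.
- by apply/(stalk_finite hsing hunib)/regular_expz0.
- by apply/(stalk_finite hsing hunib); apply: fa.
- by have := aP0 _ a0.
Qed.

Lemma pole_space_subspace k : subspace (pole_space k).
Proof.
split.
  apply/pole_spaceP; split=> [|a _ j _|j _]; rewrite ?expansion0 //.
  exact: (stalk_subspace _ _).1.
move=> c f h /pole_spaceP[foo fa f0] /pole_spaceP[hoo ha h0]; apply/pole_spaceP; split.
- exact: (stalk_subspace _ _).2.
- by move=> a a0; apply: regular_lin; [apply: fa|apply: ha].
- by move=> j jk; rewrite expansion_lin f0 // h0 // mulr0 addr0.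
Qed.

Lemma pole_space_pred k f : pole_space k f -> expansion (Some 0) f (- k) = 0 ->
  pole_space (k - 1) f.
Proof.
move=> /pole_spaceP[foo fa f0] fk; apply/pole_spaceP; split=> // j jk.
by have [/f0//|jk'] := ltP j (- k); rewrite (_ : j = - k) //; lia.
Qed.

Lemma pole_space_mono k : pole_space (k - 1) `<=` pole_space k.
Proof.
move=> f /pole_spaceP[foo fa f0]; apply/pole_spaceP; split=> // j jk.
by apply: f0; lia.
Qed.

(** [gaps0] compares dimensions through [has_dim], so that to exploit a non-gap one must first know
    that a dimension exists. The induction starts at n - 1 = -1: a polynomial vanishing at 0 and
    without pole at infinity is zero. *)
Lemma pole_space_finite_dim (n : nat) : exists d, has_dim (pole_space (n%:Z - 1)) d.
Proof.
elim: n => [|n [d dP]].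
  exists 0%N; exists (fun=> 0) => [[]//|f /pole_spaceP[foo fa f0]].
  have [a|p fp] := regular_finite_poly f.
    by have [->|/fa//] := eqVneq a 0; move=> j j0; apply: f0; lia.
  have p0 : p`_0 = 0.
    by have := f0 0 isT; rewrite fp expansion_poly /= addr0 comp_polyXr.
  have pn i : p`_i.+1 = 0.
    have := stalk_oo _ foo (- i.+1%:Z) isT.
    by rewrite fp expansion_poly.
  have f_0 : f = 0.
    rewrite fp (_ : p = 0) ?tofrac0 //; apply/polyP => -[|i]; rewrite coef0 //.
  exists [ffun=> 0]; split; first by rewrite big_ord0.
  by move=> c _; apply/ffunP => -[].
rewrite (_ : n.+1%:Z - 1 = n%:Z); last by lia.
have [sub|] := pselect (pole_space n%:Z `<=` pole_space (n%:Z - 1)).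
  exists d; rewrite (_ : pole_space n%:Z = pole_space (n%:Z - 1)) //.
  by apply/seteqP; split=> //; apply: pole_space_mono.
move=> /existsNP[f /not_implyP[fn nf]]; exists d.+1.
apply: (has_dim_extend (pole_space n%:Z) (pole_space (n%:Z - 1)) d f) => //.
- exact: pole_space_subspace.
- exact: pole_space_subspace.
- exact: pole_space_mono.
have fn0 : expansion (Some 0) f (- n%:Z) != 0.
  by apply/eqP => f0; apply: nf; apply: pole_space_pred.
move=> h hn; pose c := expansion (Some 0) h (- n%:Z) / expansion (Some 0) f (- n%:Z).
exists c; apply: pole_space_pred.
  apply: (subspaceB (pole_space n%:Z)) => //; first exact: pole_space_subspace.
  by apply: (subspaceZ (pole_space n%:Z)) => //; exact: pole_space_subspace.
by rewrite expansionD expansionN expansionZ /c divfK // subrr.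
Qed.

(** A function in the k-th pole space but not in the previous one is u^(-k) p with p(0) != 0. Its
    lowest term in u is the last term of its expansion in 1/u. *)
Lemma not_gaps0 (k : nat) : (0 < k)%N -> ~ gaps0 C k ->
  exists2 f, stalk (Poo C) f &
    (forall i : int, k%:Z < i -> expansion None f i = 0) /\ expansion None f k%:Z != 0.
Proof.
move=> k0 ngap.
have [f fk nf] : exists2 f, pole_space k%:Z f & ~ pole_space (k%:Z - 1) f.
  apply: contrapT => nf; apply: ngap; split=> //.
  have [d dP] := pole_space_finite_dim k; exists d; split=> //.
  rewrite -/(pole_space _) (_ : pole_space k%:Z = pole_space (k%:Z - 1)) //.
  apply/seteqP; split; last exact: pole_space_mono.
  by move=> f fk; apply: contrapT => nfk; apply: nf; exists f.
have fk0 : expansion (Some 0) f (- k%:Z) != 0.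
  by apply/eqP => f0; apply: nf; apply: pole_space_pred.
have [foo fa f0] := (pole_spaceP _ _).1 fk.
have [p fp] := laurent_polynomial k f fa f0.
exists f => //; split=> [i ki|]; rewrite fp expansionoo_laurent_poly.
  by case E: (- (i - k%:Z)) => //=; lia.
by move: fk0; rewrite fp expansion0_laurent_poly !subrr oppr0.
Qed.

Lemma expansion0_sum_expz {n : nat} (a : 'I_n -> F) (t : 'I_n -> nat) j :
  expansion (Some 0) (\sum_i Defs.cst (a i) * coord_u ^ (- (t i)%:Z)) j =
  \sum_i a i * (j == - (t i)%:Z)%:R.
Proof.
rewrite expansion_sum; apply: eq_bigr => i _.
rewrite expansionZ -[coord_u ^ _]mulr1 expansion0_u_expz -tofrac1 expansion_poly.
by rewrite poly_expansion1 opprK addr_eq0.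
Qed.

Lemma expansionoo_sum_expz {n : nat} (a : 'I_n -> F) (t : 'I_n -> nat) j :
  expansion None (\sum_i Defs.cst (a i) * coord_u ^ (- (t i)%:Z)) j =
  \sum_i a i * (j == (t i)%:Z)%:R.
Proof.
rewrite expansion_sum; apply: eq_bigr => i _.
rewrite expansionZ -[coord_u ^ _]mulr1 expansionoo_u_expz -tofrac1 expansion_poly.
by rewrite poly_expansion1 subr_eq0.
Qed.

Lemma sum_delta {n : nat} (a : 'I_n -> F) (t : 'I_n -> int) i : injective t ->
  \sum_j a j * (t i == t j)%:R = a i.
Proof.
move=> t_inj; rewrite (bigD1 i) //= eqxx mulr1 big1 ?addr0 // => j ji.
by rewrite (inj_eq t_inj) eq_sym (negPf ji) mulr0.
Qed.

(** Given g + 1 gaps, some nontrivial combination of the principal parts u^(-t_i) is that of a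
    function f in all the other local rings. The pole order of f at P_0 is the largest t_i that
    occurs, which is then not a gap. *)
Lemma gaps0_bounded {g : nat} (t : 'I_g.+1 -> nat) : arithmetic_genus C g ->
  injective t -> ~ (forall i, gaps0 C (t i)).
Proof.
move=> hg t_inj gap.
have [a a0 [f fP fP0]] :=
  principal_parts_dependent C (P0 C) (fun i => coord_u ^ (- (t i)%:Z)) hg.
have [i ai tmax] := max_index t (fun i => a i != 0) a0.
have Nt_inj : injective (fun i => - (t i)%:Z) by move=> x y /oppr_inj [/t_inj].
have fE j : j < 0 -> expansion (Some 0) f j = \sum_i a i * (j == - (t i)%:Z)%:R.
  move=> j0; have /(stalk_finite hsing hunib)/(_ j j0)/eqP := fP0.
  by rewrite expansionD expansionN expansion0_sum_expz subr_eq0 => /eqP ->.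
have [ti0 [n [dimk dimk1]]] := gap i.
have fk : pole_space (t i)%:Z f.
  apply/pole_spaceP; split.
  - by apply: fP => /esym/(P0_neq_oo hsing hP0).
  - move=> b b0; apply/(stalk_finite hsing hunib); apply: fP.
    by move=> /(nu_finite_inj hsing hunib)[/eqP]; rewrite (negPf b0).
  - move=> j jk; rewrite fE ?big1 //; last by lia.
    move=> l _; have [->|/tmax tl] := eqVneq (a l) 0; first by rewrite mul0r.
    by rewrite lt_eqF ?mulr0 //; lia.
(* At a gap the two nested pole spaces have the same dimension, so f has no pole of order t_i after
   all. *)
have sub := has_dim_full _ _ _ (pole_space_subspace _) (pole_space_mono _) dimk dimk1.
have /pole_spaceP[_ _ /(_ (- (t i)%:Z))] := sub _ fk.
rewrite fE ?(sum_delta a (fun i => - (t i)%:Z)) //; last by lia.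
by move=> /(_ ltac:(lia)) /eqP; rewrite (negPf ai).
Qed.

(** Here the u^(-t_i) are regular at P_oo, and classes are taken modulo the local ring. The global
    function f is a polynomial, being regular at the finite points, and has no pole at P_oo, so it
    is constant. Hence the combination itself lies in the local ring, and its order, the smallest
    t_i that occurs, is not a gap. *)
Lemma gaps_oo_bounded {g : nat} (t : 'I_g.+1 -> nat) : arithmetic_genus C g ->
  injective t -> ~ (forall i, gaps_oo C (t i)).
Proof.
move=> hg t_inj gap.
have [a a0 [f fP fPoo]] :=
  principal_parts_dependent C (Poo C) (fun i => coord_u ^ (- (t i)%:Z)) hg.
have [i ai tmin] := min_index t (fun i => a i != 0) a0.
have tz_inj : injective (fun i => (t i)%:Z) by move=> x y [/t_inj].
set s := \sum_(i < _) _ in fPoo.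
have [b|p fp] := regular_finite_poly f.
  by apply/(stalk_finite hsing hunib); apply: fP => /(nu_oo hunib).
have p0 j : p`_j.+1 = 0.
  have /(_ (- j.+1%:Z) isT) := stalk_oo _ fPoo.
  rewrite expansionD expansionN expansionoo_sum_expz big1 => [|l _]; last by rewrite mulr0.
  by rewrite sub0r fp expansion_poly /= => /eqP; rewrite oppr_eq0 => /eqP.
have fc : f = Defs.cst p`_0.
  by rewrite fp /Defs.cst; congr (_%:F); apply/polyP => -[|j]; rewrite coefC /=.
apply: (gap i); exists s.
  rewrite -(subrK f s); have := stalk_cst (Poo C) p`_0.
  rewrite -fc -[s - f]mul1r -cst1; exact: (stalk_subspace _ _).2.
split=> [j jt|]; rewrite expansionoo_sum_expz; last first.
  by rewrite (sum_delta a (fun i => (t i)%:Z)).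
rewrite big1 // => l _; have [->|/tmin tl] := eqVneq (a l) 0; first by rewrite mul0r.
by rewrite lt_eqF ?mulr0 //; lia.
Qed.

Lemma not_gaps_oo (k : nat) : ~ gaps_oo C k ->
  exists2 f, stalk (Poo C) f &
    (forall i : int, i < k%:Z -> expansion None f i = 0) /\ expansion None f k%:Z != 0.
Proof. by move=> /contrapT. Qed.

Lemma gaps_oo_gt0 k : gaps_oo C k -> (0 < k)%N.
Proof.
case: k => // [[]]; exists 1; first by rewrite -cst1; apply: stalk_cst.
split=> [j j0|]; rewrite -cst1 expansion_cst ?eqxx ?oner_eq0 //.
by rewrite lt_eqF.
Qed.

End Gaps.

(** * Leading indices and Maya diagrams *)

Section LeadingIndices.
Context {F : fieldType} {N : nat} (X : int -> 'I_N -> F).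

Definition comb (c : 'I_N -> F) (z : int) := \sum_j X z j * c j.

Lemma comb_vanish (s : seq int) : (size s < N)%N ->
  exists2 c, exists j, c j != 0 & forall z, z \in s -> comb c z = 0.
Proof.
move=> sN; have [a a0 aA] := exists_left_kernel (\matrix_(j < N, k < size s) X s`_k j) sN.
exists (a 0); first exact: rV_neq0.
move=> _ /(nthP 0)[k ks <-]; have := congr1 (fun M : 'rV_(size s) => M 0 (Ordinal ks)) aA.
by rewrite !mxE => aA0; rewrite -[RHS]aA0; apply: eq_bigr => j _; rewrite mxE mulrC.
Qed.

Lemma det_comb_eq0 (mu : 'I_N -> int) :
  \det (\matrix_(i, j) X (mu i) j) = 0 <->
  exists2 c, exists j, c j != 0 & forall i, comb c (mu i) = 0.
Proof.
rewrite -det_tr; split.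
  move/eqP/det0P => [a a0 aA]; exists (a 0); first exact: rV_neq0.
  move=> i; have := congr1 (fun M : 'rV_N => M 0 i) aA; rewrite !mxE => aA0.
  by rewrite -[RHS]aA0; apply: eq_bigr => j _; rewrite !mxE mulrC.
move=> [c [j cj] cmu]; apply/eqP/det0P; exists (\row_j c j).
  by apply/eqP => /rowP/(_ j)/eqP; rewrite !mxE (negPf cj).
apply/rowP => i; rewrite !mxE -[RHS](cmu i); apply: eq_bigr => k _.
by rewrite !mxE mulrC.
Qed.

(** [r] is < for orders at P_0 and > for degrees. The hypothesis [lead] says that every nonzero
    combination has its first nonzero index, in the sense of [r], among the values of [mu]. *)
Context (r : rel int) (mu : 'I_N -> int).
Context (lead : forall c, (exists j, c j != 0) ->
  exists2 i, comb c (mu i) != 0 & forall z, r z (mu i) -> comb c z = 0).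

Lemma det_lead_neq0 : \det (\matrix_(i, j) X (mu i) j) != 0.
Proof.
apply/eqP => /det_comb_eq0[c /lead[i ci _] c0].
by rewrite c0 eqxx in ci.
Qed.

(* Some nonzero combination vanishes at the N - 1 indices m i, i in A, and mu i,
   i outside k |: A; its leading index then lies in mu @: (k |: A). *)
Lemma det_lead_eq0 (m : 'I_N -> int) (A : {set 'I_N}) (k : 'I_N) : k \notin A ->
    (forall i i', i \notin A -> i' \in k |: A -> r (m i) (mu i')) ->
  \det (\matrix_(i, j) X (m i) j) = 0.
Proof.
move=> kA rm; apply/det_comb_eq0.
have [|c c0 cs] := comb_vanish
    ([seq m i | i <- enum A] ++ [seq mu i | i <- enum (~: (k |: A))]).
  rewrite size_cat !size_map -!cardE -[X in (_ < X)%N]card_ord -(cardsC (k |: A)).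
  by rewrite cardsU1 kA.
exists c => // i; have [iA|iA] := boolP (i \in A).
  by apply: cs; rewrite mem_cat map_f ?mem_enum.
have [i' ci' c0'] := lead _ c0; apply: c0'; apply: rm => //.
apply: contraR ci' => i'A; apply/eqP/cs.
by rewrite mem_cat orbC map_f // mem_enum inE.
Qed.

End LeadingIndices.

(** * Gap sets and Weierstrass partitions *)

Section WeierstrassPartition.
Context (G : set nat) (finG : finite_set G) (posG : forall k, G k -> (0 < k)%N).
Let w := sort leq (fset_set G).

Lemma mem_gaps k : (k \in w) = (k \in G).
Proof. by rewrite mem_sort in_fset_set. Qed.

Lemma gaps_sorted : sorted ltn w.
Proof. by rewrite ltn_sorted_uniq_leq sort_uniq fset_uniq sort_sorted //; exact: leq_total. Qed.

Lemma gaps_nth_lt i j : (i < j < size w)%N -> (nth 0%N w i < nth 0%N w j)%N.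
Proof.
move=> /andP[ij jw]; apply: (@sorted_ltn_nth _ ltn ltn_trans 0%N w gaps_sorted) => //.
by rewrite inE (ltn_trans ij).
Qed.

(** Gaps are positive and strictly increasing. So no part of the Weierstrass partition is zero. *)
Lemma gaps_nth_gt i : (i < size w)%N -> (i < nth 0%N w i)%N.
Proof.
elim: i => [|i IH] iw; last first.
  by apply: leq_ltn_trans (IH (ltnW iw)) _; apply: gaps_nth_lt; rewrite ltnSn.
by apply: posG; have := mem_nth 0%N iw; rewrite mem_gaps inE.
Qed.

Lemma size_weierstrass : size (weierstrass_partition G) = size w.
Proof. by rewrite /weierstrass_partition size_rev size_mkseq. Qed.

Lemma nth_weierstrass i : (i < size w)%N ->
  nth 0%N (weierstrass_partition G) i = (nth 0%N w (size w - i.+1) - (size w - i.+1))%N.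
Proof.
move=> iw; rewrite /weierstrass_partition nth_rev ?size_mkseq //.
by rewrite nth_mkseq // -subn_gt0 subKn.
Qed.

Lemma weierstrass_is_partition : is_partition (weierstrass_partition G).
Proof.
apply/andP; split; last first.
  rewrite mem_rev; apply/mapP => -[k]; rewrite mem_iota add0n => /gaps_nth_gt.
  by rewrite -subn_gt0 => wi Ei; rewrite -Ei in wi.
rewrite /weierstrass_partition rev_sorted.
rewrite (_ : (fun x y => _) = leq); last by apply/funext => x; apply/funext => y.
apply/(sortedP 0%N) => i; rewrite size_mkseq => iw.
rewrite !nth_mkseq //; last exact: ltnW.
have : (nth 0%N w i < nth 0%N w i.+1)%N by apply: gaps_nth_lt; rewrite ltnSn.
rewrite -/w; lia.
Qed.

End WeierstrassPartition.

Definition maya (l : seq nat) (N : nat) (i : 'I_N) : int := (nth 0%N l i)%:Z - i.+1%:Z.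

Lemma partition_nth (l : seq nat) i j : is_partition l -> (i <= j)%N ->
  (nth 0%N l j <= nth 0%N l i)%N.
Proof.
move=> /andP[sl _] ij; have [jl|jl] := ltnP j (size l); last by rewrite nth_default.
apply: (sorted_leq_nth (rev_trans leq_trans) leqnn 0%N sl) => //.
by rewrite inE (leq_ltn_trans ij).
Qed.

Lemma maya_mono (l : seq nat) (N : nat) (i j : 'I_N) : is_partition l -> (i <= j)%N ->
  maya l N j <= maya l N i.
Proof. by move=> pl ij; have := partition_nth l i j pl ij; rewrite /maya; lia. Qed.

Section LeadingGaps.
Context {F : fieldType} {N g : nat} (X : int -> 'I_N -> F) (r : rel int) (G : set nat).
Context (gN : (g <= N)%N) (finG : finite_set G) (posG : forall k, G k -> (0 < k)%N).
Context (cardG : (#|` fset_set G| <= g)%N).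
Context (lead : forall c, (exists j, c j != 0) -> exists z,
  [/\ comb X c z != 0, forall z', r z' z -> comb X c z' = 0, - N%:Z <= z
    & z < - g%:Z \/ exists2 n, G n & z = n%:Z - g%:Z]).

(** With fewer than g gaps there would be fewer than N admissible leading indices, and N
    coefficients leave room for a nonzero combination vanishing at all of them. *)
Lemma size_gaps : size (sort leq (fset_set G)) = g.
Proof.
apply/eqP; rewrite size_sort eqn_leq cardG /= leqNgt; apply/negP => Gg.
(* The admissible indices: n - g for the gaps n, and the N - g integers from -N to -g - 1. *)
have [|c c0 cs] := comb_vanish X
    ([seq n%:Z - g%:Z | n <- fset_set G] ++ [seq - (g + i.+1)%:Z | i <- iota 0 (N - g)]).
  by rewrite size_cat !size_map size_iota addnC -ltn_subRL subKn.
have [z [cz _ zN zG]] := lead _ c0; move/eqP: cz; apply; apply: cs; rewrite mem_cat.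
apply/orP; case: zG => [zg|[n Gn ->]]; last first.
  by left; apply: map_f; rewrite in_fset_set ?inE.
right; apply/mapP; exists (absz (- z - g.+1%:Z)); last by lia.
by rewrite mem_iota; lia.
Qed.

(** The admissible indices form the Maya diagram. Counting from 0, the gap w_j belongs to row g - 1
    - j, where (w_j - j) - (g - j) = w_j - g; the indices below -g belong to the rows after the g
    parts, where the partition is padded by zeros. *)
Lemma leading_maya c : (exists j, c j != 0) -> exists2 i,
  comb X c (maya (weierstrass_partition G) N i) != 0 &
  forall z, r z (maya (weierstrass_partition G) N i) -> comb X c z = 0.
Proof.
move=> /lead[z [cz cz0 zN zG]].
suff [i zi] : exists i, z = maya (weierstrass_partition G) N i.
  by exists i; rewrite -zi.
case: zG => [zg|[n Gn zn]].
  have iN : (absz (- z - 1) < N)%N by lia.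
  exists (Ordinal iN); rewrite /maya /= nth_default; first by lia.
  by rewrite size_weierstrass size_gaps; lia.
have nw : n \in sort leq (fset_set G) by rewrite mem_gaps // inE.
have := nw; rewrite -index_mem size_gaps; set j := index _ _ => jg.
have iN : (g - j.+1 < N)%N by apply: leq_trans gN; lia.
exists (Ordinal iN); rewrite /maya /= nth_weierstrass; last by rewrite size_gaps; lia.
have := gaps_nth_gt _ finG posG j; rewrite size_gaps => /(_ jg).
rewrite (_ : (g - (g - j.+1).+1)%N = j); last by lia.
by rewrite nth_index //; lia.
Qed.

End LeadingGaps.

(** * Stable minors of a frame *)

Section Frame.
Context {F : fieldType} (xi : int -> nat -> F) (L : nat).
Context (echelon : forall j, (0 < j)%N ->
  if (L < j)%N then
    xi (- j%:Z) j = 1 /\ forall i : int, i < - j%:Z -> xi i j = 0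
  else forall i : int, i < - L%:Z -> xi i j = 0).

Lemma frame_below (N j : nat) (i : int) : (L <= N)%N -> (0 < j <= N)%N -> i < - N%:Z ->
  xi i j = 0.
Proof.
move=> LN /andP[j0 jN] iN; have := echelon _ j0.
by case: ltnP => _ => [[_]|]; apply; lia.
Qed.

(** Row N (counted from 0) has index -(N + 1), where the first N frame elements vanish and the next
    one has coefficient 1: the last row is (0, ..., 0, 1). *)
Lemma minorS (l : seq nat) (N : nat) : (L <= N)%N -> (size l <= N)%N ->
  minor xi l N.+1 = minor xi l N.
Proof.
move=> LN lN; rewrite /minor (expand_det_row _ ord_max) (bigD1 ord_max) //=.
rewrite mxE /= nth_default // sub0r.
have := echelon _ (ltn0Sn N); rewrite ltnS LN => -[-> _]; rewrite mul1r.
rewrite big1 ?addr0 => [|j jN]; last first.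
  rewrite mxE /= nth_default // sub0r (frame_below N) ?mul0r //; last by lia.
  rewrite /= ltn_neqAle -ltnS ltn_ord andbT.
  by apply: contra jN => /eqP jE; apply/eqP/val_inj.
rewrite /cofactor addnn -signr_odd odd_double expr0 mul1r.
congr (\det _); apply/matrixP => i j; rewrite !mxE /=.
by rewrite /bump (leqNgt N i) (leqNgt N j) !ltn_ord.
Qed.

Lemma xi_part_minor (l : seq nat) (N : nat) : (L <= N)%N -> (size l <= N)%N ->
  xi_part xi l = minor xi l N.
Proof.
move=> LN lN; have stable M : (N <= M)%N -> minor xi l M = minor xi l N.
  elim: M => [|M IH]; first by rewrite leqn0 => /eqP ->.
  rewrite leq_eqVlt => /predU1P[->//|]; rewrite ltnS => NM.
  by rewrite minorS ?IH // (leq_trans _ NM).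
apply: xget_unique => [|c [N0 cN0]]; first by exists N.
by rewrite -(cN0 (maxn N0 N)) ?leq_maxl // stable // leq_maxr.
Qed.

Lemma minor_maya (l : seq nat) (N : nat) :
  minor xi l N = \det (\matrix_(i, j) (fun z (j : 'I_N) => xi z j.+1) (maya l N i) j).
Proof. by []. Qed.

Lemma comb_below (N : nat) (c : 'I_N -> F) z : (L <= N)%N -> z < - N%:Z ->
  comb (fun z (j : 'I_N) => xi z j.+1) c z = 0.
Proof.
move=> LN zN; rewrite /comb big1 // => j _.
by rewrite (frame_below N) ?mul0r //= ltn_ord.
Qed.

End Frame.

Lemma frame_comb_neq0 {F : fieldType} {V : set (int -> F)} {xi} (hxi : is_frame V xi)
    {N : nat} (c : 'I_N -> F) : (exists j, c j != 0) ->
  exists z, comb (fun z (j : 'I_N) => xi z j.+1) c z != 0.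
Proof.
move=> [j0 cj0]; apply: contrapT => /forallNP nz; move: hxi => [_ _ free _].
(* Frame elements are numbered from 1 and ['I_N] from 0, hence [j.-1]. *)
pose c' j := if insub j.-1 is Some i then c i else 0.
suff : c' j0.+1 = 0 by rewrite /c' /= valK => /eqP; rewrite (negPf cj0).
apply: (free N) => [k|]; last by rewrite /= ltn_ord.
rewrite big_add1 /= big_mkord.
have /negP/negPn/eqP := nz (k - 1); rewrite /comb => sum0; rewrite -[RHS]sum0.
by apply: eq_bigr => i _; rewrite /c' /= valK mulrC.
Qed.

(** * The residue pairing on combinations of frame elements *)

Section Annihilator.
Context {F : closedFieldType} (C : rational_curve F) (g : nat).

Lemma finite_range_lin (a : F) (w w' : int -> F) : finite_range w -> finite_range w' ->
  finite_range (fun i => w i * a + w' i).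
Proof.
move=> [n [N wN]] [m [M wM]].
(* A crude common window: adding |n| + |m| once compensates for a negative start, and a second time
   reaches past n + N and m + M. *)
exists (Num.min n m), (absz n + absz m + N + M + absz n + absz m)%N => k.
have [w0|/wN] := eqVneq (w k) 0; last by lia.
by rewrite w0 mul0r add0r => /wM; lia.
Qed.

(** The sum over all integers is split only after both terms have been moved to one finite window,
    whence the hypotheses on the ranges. *)
Lemma annihilates_lin (a : F) (w w' : int -> F) : finite_range w -> finite_range w' ->
  annihilates C g w -> annihilates C g w' -> annihilates C g (fun i => w i * a + w' i).
Proof.
move=> [n [N wN]] [m [M wM]] aw aw' f Of.
pose p := Num.min n m; pose P := (absz n + absz m + N + M + absz n + absz m)%N.
have range (v e : int -> F) : (forall k, v k != 0 -> p <= k < p + P%:Z) ->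
    \sum_(i \in [set: int]) v i * e i = \sum_(i < P) v (p + i%:Z) * e (p + i%:Z).
  move=> vP; rewrite (@fsum_int_range _ p P) // => k.
  by rewrite mulf_eq0 negb_or => /andP[/vP].
have wP k : w k != 0 -> p <= k < p + P%:Z by move=> /wN; rewrite /p /P; lia.
have w'P k : w' k != 0 -> p <= k < p + P%:Z by move=> /wM; rewrite /p /P; lia.
have := aw _ Of; have := aw' _ Of; rewrite !range // => [w'0 w0|k]; last first.
  have [wk|/wP//] := eqVneq (w k) 0.
  by rewrite wk mul0r add0r => /w'P.
under eq_bigr do rewrite mulrDl mulrAC; rewrite big_split /= -mulr_suml w0 w'0.
by rewrite mul0r addr0.
Qed.

Lemma comb_annihilates {N : nat} (X : int -> 'I_N -> F) (c : 'I_N -> F) :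
    (forall j, finite_range (X ^~ j) /\ annihilates C g (X ^~ j)) ->
  finite_range (comb X c) /\ annihilates C g (comb X c).
Proof.
move=> XP; rewrite /comb; elim: (index_enum _) => [|j s [IHr IHa]].
  rewrite (_ : (fun z => _) = fun=> 0); last by apply/funext => z; rewrite big_nil.
  split; first by exists 0, 0%N => k; rewrite eqxx.
  by move=> f _; apply: fsbig1 => i _; rewrite mul0r.
rewrite (_ : (fun z => _) = fun z => X z j * c j + \sum_(i <- s) X z i * c i); last first.
  by apply/funext => z; rewrite big_cons.
have [Xr Xa] := XP j; split; first exact: finite_range_lin.
exact: annihilates_lin.
Qed.

Lemma annihilates_single (w : int -> F) f z : annihilates C g w -> stalk (Poo C) f ->
    (forall i, i != z -> w i = 0 \/ expansion None f (i + g%:Z) = 0) ->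
  w z = 0 \/ expansion None f (z + g%:Z) = 0.
Proof.
move=> aw Of H; have := aw _ Of.
rewrite (@fsum_int_range _ z 1) => [|i nz0]; last first.
  suff : i = z by lia.
  apply/eqP; apply: contraR nz0 => iz.
  by have [|->|->] := H i; rewrite ?mul0r ?mulr0.
by rewrite big_ord1 addr0 => /eqP; rewrite mulf_eq0 => /orP[]/eqP; [left|right].
Qed.

(** Pairing with the constant function 1 isolates this coefficient. It excludes z + g = 0, a value
    that is neither negative nor a gap. *)
Lemma annihilates_index (w : int -> F) : annihilates C g w -> w (- g%:Z) = 0.
Proof.
move=> aw; have [||//|] := annihilates_single w 1 (- g%:Z) aw.
- by rewrite -cst1; apply: stalk_cst.
- move=> i ig; right; rewrite -cst1 expansion_cst addr_eq0 (negPf ig) //.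
- by rewrite -cst1 expansion_cst addNr eqxx => /eqP; rewrite oner_eq0.
Qed.

End Annihilator.

(** * Schur-Weierstrass polynomials *)

Section Weight.

Lemma weightEw (m : {cmonom nat}) (d : {fset nat}) : (finsupp m `<=` d)%fset ->
  weight m = (\sum_(i <- d) m i * i.+1)%N.
Proof.
move=> md; rewrite /weight (big_fset_incl _ md) // => i _.
by rewrite -cmE_neq0 negbK => /eqP ->.
Qed.

Lemma weight1 : weight mone = 0%N.
Proof. by rewrite /weight mdom1 big_seq_fset0. Qed.

Lemma weightU i : weight (ucm i) = i.+1.
Proof. by rewrite /weight mdomU big_seq_fset1 cmUU mul1n. Qed.

Lemma weightM (m1 m2 : {cmonom nat}) : weight (mmul m1 m2) = (weight m1 + weight m2)%N.
Proof.
rewrite /weight mdomD -/(weight m1) -/(weight m2).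
rewrite (weightEw _ _ (fsubsetUl _ (finsupp m2))) (weightEw _ _ (fsubsetUr (finsupp m1) _)).
by rewrite -big_split /=; apply: eq_bigr => i _; rewrite cmM mulnDl.
Qed.

End Weight.

Section Homogeneous.
Context {F : fieldType}.
Local Notation A := {malg F[{cmonom nat}]}.
Implicit Types (p q : A) (k : int).

(** The weight is an integer, so that the zero entries [sigmaz k] with k < 0 are homogeneous of
    weight k like the others. *)
Definition weight_homogeneous k p := forall m, p@_m != 0 -> (weight m)%:Z = k.
Local Notation homog := weight_homogeneous.

Lemma homog0 k : homog k 0.
Proof. by move=> m; rewrite mcoeff0 eqxx. Qed.

Lemma homog1 : homog 0 1.
Proof. by move=> m; rewrite mcoeff1; have [->|_] := eqVneq m mone; rewrite ?weight1 ?eqxx. Qed.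

Lemma homogD k p q : homog k p -> homog k q -> homog k (p + q).
Proof.
move=> hp hq m; rewrite mcoeffD; have [->|/hp//] := eqVneq p@_m 0.
by rewrite add0r => /hq.
Qed.

Lemma homogN k p : homog k p -> homog k (- p).
Proof. by move=> hp m; rewrite mcoeffN oppr_eq0 => /hp. Qed.

Lemma homogZ k c p : homog k p -> homog k (c *: p).
Proof. by move=> hp m; rewrite mcoeffZ mulf_eq0 negb_or => /andP[_ /hp]. Qed.

Lemma homogM k k' p q : homog k p -> homog k' q -> homog (k + k') (p * q).
Proof.
move=> hp hq m; rewrite mcoeff_neq0 => /msuppM_le[m1 [m2 []]].
by rewrite -!mcoeff_neq0 => /hp <- /hq <- ->; rewrite weightM PoszD.
Qed.

Lemma homog_sum (I : Type) (r : seq I) (P : pred I) k (p : I -> A) :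
  (forall i, P i -> homog k (p i)) -> homog k (\sum_(i <- r | P i) p i).
Proof. by move=> hp; apply: big_ind => //; [apply: homog0|apply: homogD]. Qed.

Lemma homog_prod (I : Type) (r : seq I) (k : I -> int) (p : I -> A) :
  (forall i, homog (k i) (p i)) -> homog (\sum_(i <- r) k i) (\prod_(i <- r) p i).
Proof. by move=> hp; apply: big_rec2 => [|i x y _]; [apply: homog1|apply: homogM]. Qed.

Lemma homog_var i : homog i%:Z (var_x i).
Proof.
case: i => [|i]; first exact: homog0.
by move=> m; rewrite mcoeffU1; have [<-|_] := eqVneq (ucm i) m; rewrite ?weightU ?eqxx.
Qed.

Lemma homog_sigma (k : nat) : homog k%:Z (sigma k).
Proof.
apply: homog_sum => n _; apply: homogZ.
suff pn i : homog i%:Z ((\poly_(i < k.+1) var_x i) ^+ n : {poly A})`_i by [].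
elim: (n : nat) i => [|n' IH] i.
  by rewrite expr0 coef1; case: i => [|i] /=; [apply: homog1|apply: homog0].
rewrite exprS coefM; apply: homog_sum => j _.
rewrite (_ : i%:Z = (j : nat)%:Z + (i - j)%N%:Z); last first.
  by rewrite -PoszD subnKC // -ltnS.
apply: homogM => //; rewrite coef_poly; case: ifP => _; [exact: homog_var|exact: homog0].
Qed.

(** In the term of a permutation s, the weights lambda_i + s(i) - i add up to |lambda|, because s
    permutes the indices. *)
Lemma homog_sigma_part (l : seq nat) : homog (sumn l)%:Z (sigma_part l).
Proof.
apply: homog_sum => s _.
suff : homog (sumn l)%:Z (\prod_i (\matrix_(i < size l, j < size l)
          sigmaz ((nth 0%N l i)%:Z + j%:Z - i%:Z)) i (s i) : A).
  by rewrite -signr_odd; case: odd; rewrite ?expr1 ?expr0 ?mulN1r ?mul1r //; apply: homogN.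
rewrite (_ : (sumn l)%:Z = \sum_(i < size l) ((nth 0%N l i)%:Z + (s i : nat)%:Z - i%:Z)).
  apply: homog_prod => i; rewrite mxE.
  case: (_ - _) => k; [exact: homog_sigma|exact: homog0].
rewrite sumrB big_split /=.
have -> : \sum_(i < size l) (s i : nat)%:Z = \sum_(i < size l) (i : nat)%:Z :> int.
  by rewrite [RHS](reindex_inj (@perm_inj _ s)).
by rewrite addrK sumnE (big_nth 0%N) big_mkord raddf_sum.
Qed.

Section OneVariable.

(* Evaluation at x_1 = 1 and x_i = 0 for i > 1. *)
Definition only_x1 (m : {cmonom nat}) : F := (finsupp m `<=` [fset 0%N])%fset%:R.

Lemma only_x1_mmorphism : mmorphism only_x1.
Proof.
split=> [m1 m2|]; rewrite /only_x1; last by rewrite mdom1 fsub0set.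
by rewrite mdomD fsubUset -natrM mulnb.
Qed.

HB.instance Definition _ := isMultiplicative.Build _ _ only_x1 only_x1_mmorphism.

Definition at_x1 : A -> F := mmap idfun only_x1.
HB.instance Definition _ := GRing.RMorphism.copy at_x1 (mmap idfun only_x1).

Lemma at_x1_var i : at_x1 (var_x i) = (i == 1%N)%:R.
Proof.
case: i => [|i]; first by rewrite /= raddf0.
by rewrite /= /at_x1 mmapU mul1r /only_x1 mdomU fsub1set in_fset1.
Qed.

(** At this point the generating series is exp(t). *)
Lemma at_x1_sigma (k : nat) : at_x1 (sigma k) = k`!%:R^-1.
Proof.
(* For k = 0 the truncation drops the term x_1 t, whence the factor. *)
have pE : map_poly at_x1 (\poly_(i < k.+1) var_x i) = (k != 0%N)%:R *: 'X.
  apply/polyP => i; rewrite coef_map coefZ coefX coef_poly.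
  case: ltnP => [ik|ki].
    rewrite /= at_x1_var; have [i1|_] := eqVneq i 1%N; last by rewrite mulr0.
    by rewrite i1 ltnS in ik; rewrite -lt0n ik mulr1.
  rewrite /= raddf0; have [i1|_] := eqVneq i 1%N; last by rewrite mulr0.
  by rewrite i1 ltnS leqn0 in ki; rewrite ki mul0r.
rewrite /sigma raddf_sum /=.
transitivity (\sum_(n < k.+1) (n`!%:R^-1 : F) * (k == n)%:R).
  apply: eq_bigr => n _; move: (n : nat) => {}n.
  rewrite /at_x1 linearZ /= -/at_x1; congr (_ * _).
  rewrite -coef_map rmorphXn /= pE exprZn coefZ coefXn.
  have [->|_] := eqVneq k n; last by rewrite !mulr0.
  by case: n => [|n]; rewrite ?expr0 ?expr1n ?mulr1.
rewrite (bigD1 ord_max) //= eqxx mulr1 big1 ?addr0 // => n nk.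
by rewrite (_ : k == n = false) ?mulr0 //; apply: contraNF nk => /eqP kn; apply/eqP/val_inj.
Qed.

End OneVariable.

End Homogeneous.

(** * Nonvanishing of the Schur-Weierstrass polynomials *)

Section SchurNonzero.
Context {F : numFieldType}.

Definition ffact_poly (k : nat) : {poly F} := \prod_(t <- iota 0 k) ('X - t%:R%:P).

Lemma size_ffact_poly k : size (ffact_poly k) = k.+1.
Proof. by rewrite size_prod_XsubC size_iota. Qed.

Lemma ffact_poly_lead k : (ffact_poly k)`_k = 1.
Proof.
by have /monicP := monic_prod_XsubC (iota 0 k) xpredT (fun t => t%:R : F);
  rewrite lead_coefE size_ffact_poly.
Qed.

Lemma ffact_polyE k n : (ffact_poly k).[n%:R] = (n ^_ k)%:R.
Proof.
elim: k => [|k IH]; first by rewrite /ffact_poly big_nil hornerE.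
rewrite /ffact_poly -addn1 iotaD big_cat /= hornerM IH big_seq1 add0n !hornerE.
rewrite addn1 ffactnSr natrM.
have [kn|nk] := leqP k n; first by rewrite natrB.
by rewrite ffact_small // !mul0r.
Qed.

(* At x_1 = 1 the entry (i, j), multiplied by b_i!, is the falling factorial of
   b_i of length m - 1 - j, so a vector of the kernel is a polynomial of degree < m
   that vanishes at the m distinct integers b_i. *)
Lemma sigma_part_neq0 (l : seq nat) : is_partition l ->
  sigma_part l != 0 :> {malg F[{cmonom nat}]}.
Proof.
move=> pl; apply/eqP => /(congr1 at_x1).
rewrite raddf0 -det_map_mx -det_tr => /eqP/det0P.
move=> [c c0 cM]; set m := size l in c c0 cM.
pose b i := (nth 0%N l i + (m - i.+1))%N.
pose P := \sum_(j < m) c 0 j *: ffact_poly (m - j.+1).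
have Pb (i : 'I_m) : P.[(b i)%:R] = 0.
  rewrite horner_sum; have := congr1 (fun M : 'rV_m => (b i)`!%:R * M 0 i) cM.
  rewrite !mxE mulr0 mulr_sumr => sum0; rewrite -[RHS]sum0; apply: eq_bigr => j _.
  rewrite !mxE hornerZ ffact_polyE mulrCA; congr (_ * _).
  have [jb|bj] := leqP (m - j.+1) (b i).
    rewrite (_ : _ + _ - _ = (b i - (m - j.+1))%N%:Z); last first.
      by have := ltn_ord i; have := ltn_ord j; rewrite /b in jb *; lia.
    rewrite /= at_x1_sigma -(ffact_fact jb) natrM mulfK //.
    by rewrite pnatr_eq0 -lt0n fact_gt0.
  (* Here lambda_i + j - i is negative, so the matrix entry and the falling factorial both
     vanish. *)
  rewrite ffact_small //; case E: (_ - _) => [k|k]; last by rewrite /= (raddf0 at_x1) mulr0.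
  by have := ltn_ord i; have := ltn_ord j; rewrite /b in bj; lia.
have P0 : P = 0.
  apply/eqP; apply: contraT => P0.
  have := max_poly_roots P0 (rs := [seq (b i)%:R | i : 'I_m]).
  rewrite size_map -cardE card_ord => H; suff : (size P <= m)%N.
    rewrite leqNgt H //; first by apply/allP => _ /mapP[i _ ->]; apply/rootP.
    rewrite map_inj_uniq ?enum_uniq // => i j /eqP; rewrite eqr_nat => /eqP bij.
    apply/ord_inj/eqP; rewrite eqn_leq; apply/andP; split; rewrite leqNgt; apply/negP => ij.
      by have := partition_nth _ _ _ pl (ltnW ij); have := ltn_ord i; rewrite /b in bij; lia.
    by have := partition_nth _ _ _ pl (ltnW ij); have := ltn_ord j; rewrite /b in bij; lia.
  apply: (leq_trans (size_sum _ _ _)); apply/bigmax_leqP => j _.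
  apply: (leq_trans (size_scale_leq _ _)); rewrite size_ffact_poly.
  by have := ltn_ord j; lia.
(* The falling factorials have degrees m - 1 - j, so the smallest j with c_j != 0 supplies the
   leading coefficient of P. *)
have [j cj jmin] :=
  min_index (fun j : 'I_m => j : nat) (fun j => c 0 j != 0) (rV_neq0 _ c0).
have : P`_(m - j.+1) = c 0 j.
  rewrite /P coef_sum (bigD1 j) //= coefZ ffact_poly_lead mulr1 big1 ?addr0 // => i ij.
  rewrite coefZ; have [->|/jmin ji] := eqVneq (c 0 i) 0; first by rewrite mul0r.
  rewrite nth_default ?mulr0 // size_ffact_poly.
  have := ltn_ord i; have := ltn_ord j; move: ij; rewrite -(inj_eq val_inj) /=; lia.
by rewrite P0 coef0 => /esym/eqP; rewrite (negPf cj).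
Qed.

End SchurNonzero.

(** * The support of the tau function *)

Lemma bounded_finite (G : set nat) (g : nat) :
    (forall t : 'I_g.+1 -> nat, injective t -> ~ (forall i, G (t i))) ->
  finite_set G /\ (#|` fset_set G| <= g)%N.
Proof.
move=> bG; have bB (B : {fset nat}) : [set` B] `<=` G -> (#|` B| <= g)%N.
  move=> BG; rewrite leqNgt; apply/negP => gB.
  have ltB (i : 'I_g.+1) : (i < size B)%N by apply: leq_trans gB.
  apply: (bG (fun i => nth 0%N B i)) => [i j /eqP|i]; last by apply/BG/mem_nth.
  by rewrite nth_uniq ?fset_uniq // => /eqP /ord_inj.
have finG : finite_set G.
  apply: contrapT => /(infinite_set_fset g.+1)[B BG].
  by rewrite ltnNge bB.
by split=> //; apply: bB; rewrite fset_setK.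
Qed.

Section TauSupport.
Context {F : closedFieldType} {C : rational_curve F}.
Context (hsing : forall P : pt C, singular P <-> P = Poo C).
Context (hunib : unibranch (Poo C)) (hP0 : smooth (P0 C)).
Context {g : nat} (hgenus : arithmetic_genus C g).
Context {xi : int -> nat -> F} (hxi : is_frame (U C g) xi).
Context {L : nat}.
Context (echelon : forall j, (0 < j)%N ->
  if (L < j)%N then
    xi (- j%:Z) j = 1 /\ forall i : int, i < - j%:Z -> xi i j = 0
  else forall i : int, i < - L%:Z -> xi i j = 0).

Let X {N : nat} (z : int) (j : 'I_N) := xi z j.+1.

Lemma frame_comb_annihilates {N : nat} (c : 'I_N -> F) :
  finite_range (comb X c) /\ annihilates C g (comb X c).
Proof.
apply: comb_annihilates => j; have [UV _ _ _] := hxi.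
have := U_annihilates hsing hunib hP0 g _ (UV j.+1 isT).
rewrite (_ : (fun i => _) = X ^~ j) //.
by apply/funext => i; rewrite addrK.
Qed.

Lemma order_gap {N : nat} (c : 'I_N -> F) : (L <= N)%N -> (exists j, c j != 0) -> exists z,
  [/\ comb X c z != 0, forall z', z' < z -> comb X c z' = 0, - N%:Z <= z
    & z < - g%:Z \/ exists2 n, gaps0 C n & z = n%:Z - g%:Z].
Proof.
move=> LN /(frame_comb_neq0 hxi)[z0 vz0].
have [[n0 [M vM]] va] := frame_comb_annihilates c; set v := comb X c in vz0 vM va *.
have lv : is_laurent v.
  by exists n0 => k kn; apply/eqP; apply: contraTT kn => /vM /andP[]; rewrite -leNgt.
have [|z [zv vz]] := laurent_order v lv.
  by move=> v0; move: vz0; rewrite -/v v0 eqxx.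
have zN : - N%:Z <= z.
  by rewrite leNgt; apply: contra vz => zN; rewrite /v (comb_below _ _ echelon).
exists z; split=> //.
have [zg|gz] := ltP z (- g%:Z); [by left|right].
have zNg : z != - g%:Z by apply: contra_neq vz => ->; apply: annihilates_index va.
have [n nz] : exists n : nat, z = n.+1%:Z - g%:Z.
  by have [k zk] := int_offset _ _ gz; exists k.-1; lia.
exists n.+1 => //; apply: contrapT.
move=> /(not_gaps0 hsing hunib hP0 _ (ltn0Sn n))[f Of [f0 fn]].
have [i iz|/eqP|] := annihilates_single C g v f z va Of; last 2 first.
- by rewrite (negPf vz).
- by rewrite nz subrK => /eqP; rewrite (negPf fn).
(* Below z the combination vanishes; above z the expansion of f at infinity has already stopped. *)
have [/zv|zi] := ltP i z; [by left|right].
by apply: f0; lia.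
Qed.

Lemma degree_gap {N : nat} (c : 'I_N -> F) : (L <= N)%N -> (exists j, c j != 0) -> exists z,
  [/\ comb X c z != 0, forall z', z' > z -> comb X c z' = 0, - N%:Z <= z
    & z < - g%:Z \/ exists2 n, gaps_oo C n & z = n%:Z - g%:Z].
Proof.
move=> LN /(frame_comb_neq0 hxi)[z0 vz0].
have [[n0 [M vM]] va] := frame_comb_annihilates c; set v := comb X c in vz0 vM va *.
(* Reversing the indices turns the degree into an order; the reversed series is Laurent because v
   has finite support. *)
have lv : is_laurent (fun k => v (- k)).
  exists (- (n0 + M%:Z)) => k kn; apply/eqP; apply: contraTT kn => /vM /andP[_].
  by rewrite -leNgt; lia.
have [|z' [zv' vz]] := laurent_order _ lv.
  move=> v0; move: vz0; have /= := congr1 (fun s => s (- z0)) v0.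
  by rewrite opprK -/v => ->; rewrite eqxx.
pose z := - z'; have zv i : z < i -> v i = 0.
  by move=> zi; rewrite -(opprK i); apply: zv'; rewrite /z in zi; lia.
rewrite -/z in vz.
have zN : - N%:Z <= z.
  by rewrite leNgt; apply: contra vz => zN; rewrite /v (comb_below _ _ echelon).
exists z; split=> //.
have [zg|gz] := ltP z (- g%:Z); [by left|right].
have zNg : z != - g%:Z by apply: contra_neq vz => ->; apply: annihilates_index va.
have [n nz] : exists n : nat, z = n.+1%:Z - g%:Z.
  by have [k zk] := int_offset _ _ gz; exists k.-1; lia.
exists n.+1 => //; apply: contrapT => /not_gaps_oo[f Of [f0 fn]].
have [i iz|/eqP|] := annihilates_single C g v f z va Of; last 2 first.
- by rewrite (negPf vz).
- by rewrite nz subrK => /eqP; rewrite (negPf fn).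
have [/zv|zi] := ltP z i; [by left|right].
by apply: f0; lia.
Qed.

Lemma gaps0_finite : finite_set (gaps0 C) /\ (#|` fset_set (gaps0 C)| <= g)%N.
Proof. by apply: bounded_finite => t; apply: gaps0_bounded. Qed.

Lemma gaps_oo_finite : finite_set (gaps_oo C) /\ (#|` fset_set (gaps_oo C)| <= g)%N.
Proof. by apply: bounded_finite => t; apply: gaps_oo_bounded. Qed.

Lemma gaps0_gt0 k : gaps0 C k -> (0 < k)%N.
Proof. by case. Qed.

Let l0 := weierstrass_partition (gaps0 C).
Let loo := weierstrass_partition (gaps_oo C).

Lemma l0_partition : is_partition l0.
Proof. by have [fG _] := gaps0_finite; apply: weierstrass_is_partition fG gaps0_gt0. Qed.

Lemma loo_partition : is_partition loo.
Proof.
by have [fG _] := gaps_oo_finite; apply: weierstrass_is_partition fG (@gaps_oo_gt0 _ _).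
Qed.

Lemma leading_maya0 {N : nat} (c : 'I_N -> F) : (L <= N)%N -> (g <= N)%N ->
  (exists j, c j != 0) -> exists2 i,
  comb X c (maya l0 N i) != 0 & forall z, z < maya l0 N i -> comb X c z = 0.
Proof.
move=> LN gN; have [fG cG] := gaps0_finite.
exact: (leading_maya _ (fun x y => x < y) _ gN fG gaps0_gt0 cG (fun c => order_gap c LN)).
Qed.

Lemma leading_mayaoo {N : nat} (c : 'I_N -> F) : (L <= N)%N -> (g <= N)%N ->
  (exists j, c j != 0) -> exists2 i,
  comb X c (maya loo N i) != 0 & forall z, z > maya loo N i -> comb X c z = 0.
Proof.
move=> LN gN; have [fG cG] := gaps_oo_finite.
exact: (leading_maya _ (fun x y => x > y) _ gN fG (@gaps_oo_gt0 _ _) cG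
  (fun c => degree_gap c LN)).
Qed.

Lemma xi_part_l0_neq0 : xi_part xi l0 != 0.
Proof.
(* Large enough for the minor to have its stable value and for the Maya diagram to contain all
   leading indices. *)
pose N := (L + g + size l0)%N.
have [LN gN lN] : [/\ L <= N, g <= N & size l0 <= N]%N by rewrite /N; split; lia.
rewrite (xi_part_minor _ _ echelon l0 N) // minor_maya.
exact: (@det_lead_neq0 _ N X (fun x y => x < y) (maya l0 N)
  (fun c => leading_maya0 c LN gN)).
Qed.

Lemma xi_part_loo_neq0 : xi_part xi loo != 0.
Proof.
pose N := (L + g + size loo)%N.
have [LN gN lN] : [/\ L <= N, g <= N & size loo <= N]%N by rewrite /N; split; lia.
rewrite (xi_part_minor _ _ echelon loo N) // minor_maya.
exact: (@det_lead_neq0 _ N X (fun x y => x > y) (maya loo N)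
  (fun c => leading_mayaoo c LN gN)).
Qed.

(** If l_k < (l0)_k, monotonicity puts the Maya indices of l in all rows i >= k below those of l0 in
    all rows i' <= k. This is the configuration of [det_lead_eq0] with the rows before k as [A]. *)
Lemma xi_part_ge (l : seq nat) k : is_partition l -> xi_part xi l != 0 ->
  (nth 0%N l0 k <= nth 0%N l k)%N.
Proof.
move=> pl; apply: contra_neqT; rewrite -ltnNge => lk.
pose N := (L + g + size l + k.+1)%N.
have [LN gN lN kN] : [/\ L <= N, g <= N, size l <= N & k < N]%N by rewrite /N; split; lia.
rewrite (xi_part_minor _ _ echelon l N) // minor_maya.
apply: (@det_lead_eq0 _ N X (fun x y => x < y) (maya l0 N)
  (fun c => leading_maya0 c LN gN) (maya l N)
  [set i : 'I_N | (i < k)%N] (Ordinal kN)) => [|i i']; first by rewrite inE /= ltnn.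
rewrite !inE -leqNgt => ki ik.
have {}ik : (i' <= k)%N by case/orP: ik => [/eqP ->|/ltnW].
have := maya_mono l N (Ordinal kN) i pl ki.
have := maya_mono l0 N i' (Ordinal kN) l0_partition ik.
by rewrite /maya /=; lia.
Qed.

(** The mirror image: if l_k > (loo)_k, the rows up to k of l lie above the rows from k on of loo,
    and [A] consists of the rows after k. *)
Lemma xi_part_le (l : seq nat) k : is_partition l -> xi_part xi l != 0 ->
  (nth 0%N l k <= nth 0%N loo k)%N.
Proof.
move=> pl; apply: contra_neqT; rewrite -ltnNge => lk.
pose N := (L + g + size l + k.+1)%N.
have [LN gN lN kN] : [/\ L <= N, g <= N, size l <= N & k < N]%N by rewrite /N; split; lia.
rewrite (xi_part_minor _ _ echelon l N) // minor_maya.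
apply: (@det_lead_eq0 _ N X (fun x y => x > y) (maya loo N)
  (fun c => leading_mayaoo c LN gN) (maya l N)
  [set i : 'I_N | (k < i)%N] (Ordinal kN)) => [|i i']; first by rewrite inE /= ltnn.
rewrite !inE -leqNgt => ik ki.
have {}ki : (k <= i')%N by case/orP: ki => [/eqP ->|/ltnW].
have := maya_mono l N i (Ordinal kN) pl ik.
have := maya_mono loo N (Ordinal kN) i' loo_partition ki.
by rewrite /maya /=; lia.
Qed.

End TauSupport.

(** * Containment and weight of partitions *)

Section Partitions.
Implicit Types l m : seq nat.

Lemma sumn_nth l (n : nat) : (size l <= n)%N -> sumn l = (\sum_(i < n) nth 0%N l i)%N.
Proof.
move=> ln; rewrite sumnE (big_nth 0%N) (big_nat_widen _ _ n) // big_mkcond big_mkord.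
by apply: eq_bigr => i _; case: ltnP => // /(nth_default 0%N) ->.
Qed.

Lemma partition_nth_gt0 l k : is_partition l -> (0 < nth 0%N l k)%N = (k < size l)%N.
Proof.
move=> /andP[_ l0]; case: (ltnP k (size l)) => kl; last by rewrite nth_default.
by rewrite lt0n; apply: contra l0 => /eqP <-; apply: mem_nth.
Qed.

(** Partitions have no zero parts, so padding by zeros does not lose the length. *)
Lemma partition_eq l m : is_partition l -> is_partition m ->
  (forall k, nth 0%N l k = nth 0%N m k) -> l = m.
Proof.
move=> pl pm lm; apply: (@eq_from_nth _ 0%N) => //.
apply/eqP; rewrite eqn_leq; apply/andP; split; rewrite leqNgt; apply/negP.
  by rewrite -(partition_nth_gt0 _ _ pl) lm nth_default.
by rewrite -(partition_nth_gt0 _ _ pm) -lm nth_default.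
Qed.

Lemma sumn_le l m : (forall k, nth 0%N l k <= nth 0%N m k)%N -> (sumn l <= sumn m)%N.
Proof.
move=> lm; rewrite (sumn_nth l _ (leq_addr (size m) _)) (sumn_nth m _ (leq_addl (size l) _)).
by apply: leq_sum.
Qed.

Lemma sumn_le_eq l m : is_partition l -> is_partition m ->
  (forall k, nth 0%N l k <= nth 0%N m k)%N -> sumn l = sumn m -> l = m.
Proof.
move=> pl pm lm slm; apply: partition_eq => // k.
pose n := (size l + size m + k.+1)%N.
have kn : (k < n)%N by rewrite /n; lia.
have ln : (size l <= n)%N by rewrite /n; lia.
have mn : (size m <= n)%N by rewrite /n; lia.
apply/eqP; rewrite eqn_leq lm /= leqNgt; apply/negP => lmk.
move: slm; rewrite (sumn_nth l n) // (sumn_nth m n) //.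
rewrite (bigD1 (Ordinal kn)) //= [RHS](bigD1 (Ordinal kn)) //= => sE.
have : (\sum_(i < n | i != Ordinal kn) nth 0%N l i <=
        \sum_(i < n | i != Ordinal kn) nth 0%N m i)%N by apply: leq_sum.
by move=> /(leq_add lmk); rewrite addSn sE ltnn.
Qed.

(** Such a partition has at most [size m] parts, each at most [sumn m], so a length and a tuple of
    bounded entries encode it. *)
Lemma partitions_below_finite m :
  finite_set [set l | is_partition l /\ forall k, (nth 0%N l k <= nth 0%N m k)%N].
Proof.
pose n := size m; pose M := sumn m.
pose f (x : 'I_n.+1 * n.-tuple 'I_M.+1) : seq nat := take x.1 (map (@nat_of_ord _) x.2).
apply: (@sub_finite_set _ _ (f @` setT)); last first.
  by apply: finite_image; exact: finite_finset.
move=> l [pl lm].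
have ln : (size l < n.+1)%N.
  rewrite ltnS leqNgt; apply/negP; rewrite -(partition_nth_gt0 _ _ pl) => ln.
  by have := leq_trans ln (lm n); rewrite nth_default.
have lM k : (nth 0%N l k < M.+1)%N.
  rewrite ltnS; apply: leq_trans (lm k) _.
  have [km|km] := ltnP k (size m); last by rewrite nth_default.
  by rewrite /M (sumn_nth m (size m)) // (bigD1 (Ordinal km)) //= leq_addr.
exists (Ordinal ln, [tuple inord (nth 0%N l i) | i < n]) => //.
rewrite /f /=; apply: (@eq_from_nth _ 0%N).
  by rewrite size_takel // size_map size_tuple card_ord -ltnS.
rewrite size_takel => [i il|]; last by rewrite size_map size_tuple card_ord -ltnS.
have i_n : (i < n)%N by apply: leq_trans il _.
rewrite nth_take // (nth_map ord0) ?size_tuple ?card_ord //.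
by rewrite (nth_map (Ordinal i_n)) ?size_enum_ord // inordK nth_enum_ord.
Qed.

End Partitions.

Lemma mcoeff_lin2 {F : fieldType} (a b : F) (p q r : {malg F[{cmonom nat}]}) m :
  (a *: p + q + b *: r)@_m = a * p@_m + q@_m + b * r@_m.
Proof. by rewrite 2!mcoeffD; congr (_ + _ + _); apply: mcoeffZ. Qed.

(** * Weight components of the tau function *)

Section TauComponents.
Context {F : fieldType} (xi : int -> nat -> F).

(** By homogeneity, monomials of weight |l1| occur only in sigma_l with |l| = |l1|. This serves at
    the two extreme weights, where a single partition contributes. *)
Lemma tau_component (l1 : seq nat) m : is_partition l1 ->
    (forall l, is_partition l -> xi_part xi l != 0 -> sumn l = sumn l1 -> l = l1) ->
  weight_component (tau xi) (sumn l1) m = (xi_part xi l1 *: sigma_part l1)@_m.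
Proof.
move=> pl1 uniq_l1; rewrite /weight_component mcoeffZ; case: eqP => [ml1|ml1]; last first.
  have [->|s0] := eqVneq (mcoeff m (@sigma_part F l1)) 0; first by rewrite mulr0.
  by have := homog_sigma_part l1 m s0 => -[].
rewrite /tau -(@fsbig_widen _ _ _ _ [set l1]) ?fsbig_set1 // => [l ->//|l [pl ll1]].
apply/eqP; rewrite mulf_eq0; apply: contra_notT ll1.
move=> /norP[xl /(homog_sigma_part l m)[lm]].
by apply: uniq_l1 => //; rewrite -lm.
Qed.

Lemma tau_component0 (n : nat) m :
    (forall l, is_partition l -> xi_part xi l != 0 -> sumn l <> n) ->
  weight_component (tau xi) n m = 0.
Proof.
move=> nl; rewrite /weight_component; case: eqP => // mn; apply: fsbig1 => l pl.
apply/eqP; rewrite mulf_eq0; apply: contraT => /norP[xl /(homog_sigma_part l m)[lm]].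
by case: (nl _ pl xl); rewrite -lm.
Qed.

Lemma mcoeff_fsum (B : set (seq nat)) m : finite_set B ->
  (\sum_(l \in B) xi_part xi l *: sigma_part l)@_m =
  \sum_(l \in B) xi_part xi l * (sigma_part l)@_m.
Proof.
move=> finB; rewrite [in LHS]fsbig_finite // [in RHS]fsbig_finite //.
rewrite (big_morph (mcoeff m) (mcoeffD m) (mcoeff0 m)).
by apply: eq_bigr => l _; rewrite mcoeffZ.
Qed.

End TauComponents.

Theorem proposition4p4 (R : realType) (C : rational_curve R[i]) (g : nat)
    (hGor : gorenstein C)
    (hgenus : arithmetic_genus C g)
    (hsing : forall P : pt C, singular P <-> P = Poo C)
    (hunib : unibranch (Poo C))
    (hP0 : smooth (P0 C))
    (xi : int -> nat -> R[i])
    (hxi : is_frame (U C g) xi) :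
  let l0 := weierstrass_partition (gaps0 C) in
  let loo := weierstrass_partition (gaps_oo C) in
  [/\ xi_part xi l0 != 0,
      xi_part xi loo != 0,
      forall m, tau xi m =
        (if l0 == loo then xi_part xi l0 *: sigma_part l0
         else xi_part xi l0 *: sigma_part l0
            + \sum_(l \in [set l | [/\ is_partition l, young_lt l0 l
                                     & young_lt l loo]])
                xi_part xi l *: sigma_part l
            + xi_part xi loo *: sigma_part loo)@_m
    & [/\ exists p : {malg R[i][{cmonom nat}]}, forall m, tau xi m = p@_m,
          exists2 c : R[i], c != 0 & lowest_term (tau xi) (c *: sigma_part l0)
        & exists2 c : R[i], c != 0 &
            highest_term (tau xi) (c *: sigma_part loo)]].
Proof.
move=> l0 loo; have [_ _ _ [d echelon]] := hxi.
have x0 : xi_part xi l0 != 0 := xi_part_l0_neq0 hsing hunib hP0 hgenus hxi echelon.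
have xoo : xi_part xi loo != 0 := xi_part_loo_neq0 hsing hunib hP0 hgenus hxi echelon.
have p0 : is_partition l0 := l0_partition hsing hunib hP0 hgenus.
have poo : is_partition loo := loo_partition hsing hunib hgenus.
have ge0 l k : is_partition l -> xi_part xi l != 0 -> (nth 0 l0 k <= nth 0 l k)%N :=
  xi_part_ge hsing hunib hP0 hgenus hxi echelon l k.
have leoo l k : is_partition l -> xi_part xi l != 0 -> (nth 0 l k <= nth 0 loo k)%N :=
  xi_part_le hsing hunib hP0 hgenus hxi echelon l k.
have tauE m : tau xi m =
        (if l0 == loo then xi_part xi l0 *: sigma_part l0
         else xi_part xi l0 *: sigma_part l0
            + \sum_(l \in [set l | [/\ is_partition l, young_lt l0 l
                                     & young_lt l loo]])
                xi_part xi l *: sigma_part l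
            + xi_part xi loo *: sigma_part loo)@_m.
  case: eqP => [l0oo|l0oo].
    rewrite mcoeffZ /tau -(@fsbig_widen _ _ _ _ [set l0]) ?fsbig_set1 //.
      by move=> l ->.
    move=> l [pl ll0].
    apply/eqP; rewrite mulf_eq0; apply: contra_notT ll0 => /norP[xl _].
    apply: partition_eq => // k; have := leoo _ k pl xl.
    by rewrite -l0oo => lk; apply/eqP; rewrite eqn_leq lk ge0.
  set B := [set l | _].
  have finB : finite_set B.
    apply: sub_finite_set (partitions_below_finite loo) => l [pl _ [lloo _]].
    by split.
  rewrite mcoeff_lin2 mcoeff_fsum // /tau.
  (* By [ge0] and [leoo], a partition with nonzero coefficient that is neither l0 nor loo lies in
     B. *)
  rewrite -(@fsbig_widen _ _ _ _ ([set l0] `|` (B `|` [set loo]))).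
  - rewrite fsbigU0 ?fsbigU0 ?fsbig_set1 //.
    + exact: addrA.
    + by move=> l [[_ _ [_ H]]] /H.
    + by rewrite finite_setU.
    + move=> l [->]; case=> [[_ [_ H] _]|/l0oo//]; exact: H.
  - by move=> l [->|[[]|->]].
  - move=> l [pl /not_orP[ll0 /not_orP[lB lloo]]].
    apply/eqP; rewrite mulf_eq0; apply: contra_notT lB => /norP[xl _].
    split=> //; split.
    + by move=> k; apply: ge0.
    + by move/esym/ll0.
    + by move=> k; apply: leoo.
    + exact: lloo.
have lowP : lowest_term (tau xi) (xi_part xi l0 *: sigma_part l0).
  split; first by rewrite scaler_eq0 negb_or x0 sigma_part_neq0.
  exists (sumn l0); split=> [m|k kl0 m].
    (* The support lies above l0, and containment with equal weight forces equality. *)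
    apply: tau_component => // l pl xl ll0.
    by apply/esym/sumn_le_eq => // i; apply: ge0.
  apply: tau_component0 => l pl xl lk; move: kl0.
  by rewrite -lk ltnNge => /negP; apply; apply: sumn_le => i; apply: ge0.
have highP : highest_term (tau xi) (xi_part xi loo *: sigma_part loo).
  split; first by rewrite scaler_eq0 negb_or xoo sigma_part_neq0.
  exists (sumn loo); split=> [m|k kl0 m].
    apply: tau_component => // l pl xl lloo.
    by apply: sumn_le_eq => // i; apply: leoo.
  apply: tau_component0 => l pl xl lk; move: kl0.
  by rewrite -lk ltnNge => /negP; apply; apply: sumn_le => i; apply: leoo.
split=> //; split; first by eexists; apply: tauE.
  by exists (xi_part xi l0); [exact: x0|exact: lowP].
by exists (xi_part xi loo); [exact: xoo|exact: highP].
Qed.
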